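(* If the $\mathcal O_X$-modules $\mathscr M_\alpha$ ($\alpha\in E$) are locally projective, then the category $\mathbf{Rep}(\mathscr MQ)$ of $\mathscr M$-twisted representations of $Q$ and the category $\mathscr MQ\text{-}\mathbf{mod}$ of left $\mathscr MQ$-modules are equivalent. In particular, for every sheaf of two-sided ideals $\mathscr K\subset\mathscr MQ$, with $\mathscr A=\mathscr MQ/\mathscr K$, the category $\mathscr A\text{-}\mathbf{mod}$ of left $\mathscr A$-modules is (via restriction of scalars and this equivalence) a full subcategory of $\mathbf{Rep}(\mathscr MQ)$.
   Context: $Q=(I,E,h,t)$ is a finite quiver: $I$ is the finite set of vertices, $E$ the finite set of arrows, $t,h\colon E\to I$ the tail and head maps. $(X,\mathcal O_X)$ is a ringed space. $\mathcal B=\bigoplus_{i\in I}\mathcal O_Xe_i$ is the sheaf of $\mathcal O_X$-algebras with $e_ie_j=\delta_{ij}e_i$ and unit $\sum_i e_i$. $\{\mathscr M_\alpha\}_{\alpha\in E}$ is a collection of $\mathcal O_X$-modules; each $\mathscr M_\alpha$ is a $\mathcal B$-bimodule via $e_ix=x$ if $i=h(\alpha)$ and $0$ otherwise, $xe_i=x$ if $i=t(\alpha)$ and $0$ otherwise. Put $\mathscr M=\bigoplus_{\alpha\in E}\mathscr M_\alpha$. The $\mathscr M$-twisted quiver algebra is the tensor algebra $\mathscr MQ=T_{\mathcal B}\mathscr M$. An object of $\mathbf{Rep}(\mathscr MQ)$ is a pair $(\{\mathcal V_i\}_{i\in I},\{\phi_\alpha\}_{\alpha\in E})$ where each $\mathcal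 V_i$ is an $\mathcal O_X$-module and each $\phi_\alpha\colon\mathscr M_\alpha\otimes_{\mathcal O_X}\mathcal V_{t(\alpha)}\to\mathcal V_{h(\alpha)}$ is a morphism of $\mathcal O_X$-modules. A morphism $(\{\mathcal V_i\},\{\phi_\alpha\})\to(\{\mathcal W_i\},\{\psi_\alpha\})$ is a collection of $\mathcal O_X$-module morphisms $f_i\colon\mathcal V_i\to\mathcal W_i$ with $f_{h(\alpha)}\circ\phi_\alpha=\psi_\alpha\circ(\mathrm{id}\otimes f_{t(\alpha)})$ for all $\alpha\in E$. *)

(* Defs.v *)
From HB Require Import structures.
From mathcomp Require Import all_boot all_order all_algebra.
From mathcomp Require Import all_classical topology.

Set Implicit Arguments.
Unset Strict Implicit.
Unset Printing Implicit Defensive.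

Import GRing.Theory.
Local Open Scope classical_set_scope.
Local Open Scope ring_scope.
Local Open Scope quotient_scope.

Record category := Category {
  obj : Type;
  hom : obj -> obj -> Type;
  idm : forall a, hom a a;
  cmp : forall a b c, hom b c -> hom a b -> hom a c;
  cmp_idl : forall a b (f : hom a b), cmp (idm b) f = f;
  cmp_idr : forall a b (f : hom a b), cmp f (idm a) = f;
  cmp_assoc : forall a b c d (h : hom c d) (g : hom b c) (f : hom a b),
    cmp h (cmp g f) = cmp (cmp h g) f }.

Arguments idm {_} a.
Arguments cmp {_ a b c}.

Record functor (C D : category) := Functor {
  fobj : obj C -> obj D;
  fmap : forall a b, hom a b -> hom (fobj a) (fobj b);
  fmap_id : forall a, fmap (idm a) = idm (fobj a);
  fmap_cmp : forall a b c (g : hom b c) (f : hom a b),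
    fmap (cmp g f) = cmp (fmap g) (fmap f) }.

Arguments fobj {C D} _ _.
Arguments fmap {C D} _ {a b} _.

Definition id_functor (C : category) : functor C C :=
  @Functor C C id (fun _ _ f => f) (fun _ => erefl) (fun _ _ _ _ _ => erefl).

Definition comp_functor (C D E : category) (G : functor D E)
  (F : functor C D) : functor C E.
Proof.
refine (@Functor C E (fun a => fobj G (fobj F a))
  (fun a b f => fmap G (fmap F f)) _ _).
- by move=> a; rewrite !fmap_id.
- by move=> a b c g f; rewrite !fmap_cmp.
Defined.

Definition is_iso (C : category) (a b : obj C) (f : hom a b) : Prop :=
  exists g : hom b a, cmp g f = idm a /\ cmp f g = idm b.

Definition naturally_iso (C D : category) (F G : functor C D) : Prop :=
  exists eta : forall a, hom (fobj F a) (fobj G a),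
    (forall a, is_iso (eta a)) /\
    (forall a b (f : hom a b), cmp (fmap G f) (eta a) = cmp (eta b) (fmap F f)).

Definition is_equivalence (C D : category) (F : functor C D) : Prop :=
  exists G : functor D C,
    naturally_iso (comp_functor G F) (id_functor C) /\
    naturally_iso (comp_functor F G) (id_functor D).

Definition fully_faithful (C D : category) (F : functor C D) : Prop :=
  forall a b : obj C, bijective (fun f : hom a b => fmap F f).

Section Presheaves.
Variable X : topologicalType.

Record opens := Opens { oset :> set X; oset_open : open oset }.

Definition openI (U V : opens) : opens :=
  Opens (openI (oset_open U) (oset_open V)).

Lemma openIl (U V : opens) : openI U V `<=` U. Proof. exact: subIsetl. Qed.
Lemma openIr (U V : opens) : openI U V `<=` V. Proof. exact: subIsetr. Qed.

Record presheaf := Presheaf {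
  psec :> opens -> Type;
  pres : forall U V : opens, V `<=` U -> psec U -> psec V;
  pres_id : forall (U : opens) (h : U `<=` U) s, pres h s = s;
  pres_comp : forall (U V W : opens) (hVU : V `<=` U) (hWV : W `<=` V)
    (hWU : W `<=` U) s, pres hWV (pres hVU s) = pres hWU s }.

Definition is_sheaf (F : presheaf) : Prop :=
  forall (U : opens) (C : Type) (V : C -> opens) (hV : forall i, V i `<=` U),
  U `<=` \bigcup_i V i ->
  (forall s t : F U, (forall i, pres (hV i) s = pres (hV i) t) -> s = t) /\
  (forall s : forall i, F (V i),
    (forall i j, pres (@openIl (V i) (V j)) (s i) = pres (@openIr (V i) (V j)) (s j)) ->
    exists t : F U, forall i, pres (hV i) t = s i).

Record zpresheaf := ZPresheaf {
  zsec :> opens -> zmodType;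
  zres : forall U V : opens, V `<=` U -> {additive zsec U -> zsec V};
  zres_id : forall (U : opens) (h : U `<=` U) s, zres h s = s;
  zres_comp : forall (U V W : opens) (hVU : V `<=` U) (hWV : W `<=` V)
    (hWU : W `<=` U) s, zres hWV (zres hVU s) = zres hWU s }.

Definition psh_of_z (F : zpresheaf) : presheaf :=
  @Presheaf (fun U => F U) (fun U V h => zres F h) (@zres_id F) (@zres_comp F).

Record ringPresheaf := RingPresheaf {
  rsec :> opens -> pzRingType;
  rres : forall U V : opens, V `<=` U -> {rmorphism rsec U -> rsec V};
  rres_id : forall (U : opens) (h : U `<=` U) s, rres h s = s;
  rres_comp : forall (U V W : opens) (hVU : V `<=` U) (hWV : W `<=` V)
    (hWU : W `<=` U) s, rres hWV (rres hVU s) = rres hWU s }.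

Definition z_of_ring (A : ringPresheaf) : zpresheaf :=
  @ZPresheaf (fun U => A U) (fun U V h => rres A h) (@rres_id A) (@rres_comp A).

Record ringSheaf := RingSheaf {
  ring_psh :> ringPresheaf;
  ring_sheafP : is_sheaf (psh_of_z (z_of_ring ring_psh)) }.

(* A structure sheaf: [(X, O)] is a ringed space when [O : comRingSheaf X]. *)
Record comRingSheaf := ComRingSheaf {
  com_ring :> ringSheaf;
  com_mulC : forall (U : opens) (a b : com_ring U), a * b = b * a }.

Record modPresheaf (A : ringPresheaf) := ModPresheaf {
  msec :> forall U : opens, lmodType (A U);
  mres : forall U V : opens, V `<=` U -> {additive msec U -> msec V};
  mresZ : forall (U V : opens) (h : V `<=` U) (a : A U) (s : msec U),
    mres h (a *: s) = rres A h a *: mres h s;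
  mres_id : forall (U : opens) (h : U `<=` U) s, mres h s = s;
  mres_comp : forall (U V W : opens) (hVU : V `<=` U) (hWV : W `<=` V)
    (hWU : W `<=` U) s, mres hWV (mres hVU s) = mres hWU s }.

Definition z_of_mod (A : ringPresheaf) (M : modPresheaf A) : zpresheaf :=
  @ZPresheaf (fun U => M U) (fun U V h => mres M h) (@mres_id A M) (@mres_comp A M).

Record modSheaf (A : ringSheaf) := ModSheaf {
  mod_psh :> modPresheaf A;
  mod_sheafP : is_sheaf (psh_of_z (z_of_mod mod_psh)) }.

(* Morphisms of (pre)sheaves of A-modules defined over an open set D only, i.e.
   morphisms from the restriction of M to D to the restriction of N to D. *)
Record modHomOn (D : opens) (A : ringPresheaf) (M N : modPresheaf A) := ModHomOn {
  mhon : forall U : opens, U `<=` D -> {linear M U -> N U};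
  mhon_res : forall (U V : opens) (hU : U `<=` D) (hV : V `<=` D) (h : V `<=` U) s,
    mres N h (mhon hU s) = mhon hV (mres M h s) }.

Record modHom (A : ringPresheaf) (M N : modPresheaf A) := ModHom {
  mhom :> forall U : opens, {linear M U -> N U};
  mhom_res : forall (U V : opens) (h : V `<=` U) s,
    mres N h (mhom U s) = mhom V (mres M h s) }.

Lemma linear_ext (R : pzRingType) (U V : lmodType R) (f g : {linear U -> V}) :
  f =1 g -> f = g.
Proof.
case: f => f [[f1] [f2]]; case: g => g [[g1] [g2]] /= /funext fg.
by subst g; rewrite (Prop_irrelevance f1 g1) (Prop_irrelevance f2 g2).
Qed.

Lemma modHom_ext (A : ringPresheaf) (M N : modPresheaf A) (f g : modHom M N) :
  (forall U s, f U s = g U s) -> f = g.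
Proof.
case: f => f f1; case: g => g g1 /= fg.
have e : f = g by apply: functional_extensionality_dep => U; apply: linear_ext => s; exact: fg.
by subst g; rewrite (Prop_irrelevance f1 g1).
Qed.

Definition modHom_id (A : ringPresheaf) (M : modPresheaf A) : modHom M M :=
  @ModHom A M M (fun U => idfun) (fun _ _ _ _ => erefl).

Definition modHom_comp (A : ringPresheaf) (L M N : modPresheaf A)
  (g : modHom M N) (f : modHom L M) : modHom L N.
Proof.
refine (@ModHom A L N (fun U => g U \o f U) _).
by move=> U V h s /=; rewrite !mhom_res.
Defined.

Definition modCat (A : ringSheaf) : category.
Proof.
refine (@Category (modSheaf A) (fun M N => modHom M N)
  (fun M => modHom_id M) (fun L M N g f => modHom_comp g f) _ _ _).
- by move=> M N f; apply: modHom_ext.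
- by move=> M N f; apply: modHom_ext.
- by move=> K L M N h g f; apply: modHom_ext.
Defined.

Record ringHom (A B : ringPresheaf) := RingHom {
  rhom :> forall U : opens, {rmorphism A U -> B U};
  rhom_res : forall (U V : opens) (h : V `<=` U) s,
    rres B h (rhom U s) = rhom V (rres A h s) }.

End Presheaves.

Section Sheafification.
Variables (X : topologicalType).
Implicit Types (F G H : presheaf X) (U V W N : opens X).

(* The germ at x of a section t of F over W, as the set of all sections (W', t')
   with W' a neighbourhood of x that agree with t near x; it is empty when x is
   not in W. *)
Definition germ F W (t : F W) (x : X) : set {W' : opens X & F W'} :=
  [set p : {W' : opens X & F W'} | exists (N : opens X) (h1 : N `<=` W) (h2 : N `<=` projT1 p),
     oset N x /\ pres h1 t = pres h2 (projT2 p)].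

(* Sections of the sheafification: families of germs, given locally by sections
   of F (normalized to be empty off U). *)
Record shsec F U := ShSec {
  shval : X -> set {W : opens X & F W};
  shval_out : forall x, ~ oset U x -> shval x = set0;
  shval_loc : forall x, oset U x -> exists (W : opens X) (t : F W),
    [/\ oset W x, W `<=` U & forall y, oset W y -> shval y = germ t y] }.

HB.instance Definition _ F U := gen_eqMixin (shsec F U).
HB.instance Definition _ F U := gen_choiceMixin (shsec F U).

Lemma germ_eq F W W' (t : F W) (t' : F W') N (h : N `<=` W) (h' : N `<=` W') x :
  oset N x -> pres h t = pres h' t' -> germ t x = germ t' x.
Proof.
have sub A B (s : F A) (s' : F B) (k : N `<=` A) (k' : N `<=` B) : oset N x ->
    pres k s = pres k' s' -> germ s x `<=` germ s' x.
  move=> Nx e [C c] [P [h1 [h2 [Px eP]]]] /=.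
  exists (openI N P), (subset_trans (@openIl _ N P) k'), (subset_trans (@openIr _ N P) h2).
  split=> //=; rewrite /= in h2 eP *.
  rewrite -(pres_comp k' (@openIl _ N P)) -e.
  rewrite -(pres_comp h2 (@openIr _ N P)) -eP.
  by rewrite (pres_comp _ _ (subset_trans (@openIl _ N P) k)) (pres_comp _ _ (subset_trans (@openIl _ N P) k)).
by move=> Nx e; apply/seteqP; split; [apply: (sub _ _ _ _ h h')|apply: (sub _ _ _ _ h' h)].
Qed.

Lemma germ_self F W (t : F W) x : oset W x -> germ t x (existT _ W t).
Proof. by move=> Wx; exists W, (@subset_refl _ W), (@subset_refl _ W). Qed.

Lemma germ_eqP F W W' (t : F W) (t' : F W') x : oset W' x ->
  germ t x = germ t' x -> exists N (h : N `<=` W) (h' : N `<=` W'),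
  oset N x /\ pres h t = pres h' t'.
Proof. by move=> Wx e; move: (germ_self t' Wx); rewrite -e. Qed.

Lemma germ_res F W N (h : N `<=` W) (t : F W) x :
  oset N x -> germ (pres h t) x = germ t x.
Proof.
move=> Nx; apply: (@germ_eq _ _ _ _ _ N (@subset_refl _ N) h) => //.
by rewrite pres_id.
Qed.

Lemma germ_out F W (t : F W) x : ~ oset W x -> germ t x = set0.
Proof. by move=> Wx; apply/seteqP; split=> // p [N [h [h' [Nx e]]]]; exact: (Wx (h _ Nx)). Qed.

Lemma shsec_ext F U (s t : shsec F U) :
  (forall x, oset U x -> shval s x = shval t x) -> s = t.
Proof.
case: s t => s s1 s2 [t t1 t2] /= e.
have {}e : s = t.
  by apply/funext => x; case: (pselect (oset U x)) => [/e//|nx]; rewrite s1// t1.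
by subst t; rewrite (Prop_irrelevance s1 t1) (Prop_irrelevance s2 t2).
Qed.

Lemma shrep F U (s : shsec F U) x : oset U x -> exists W (t : F W),
  [/\ oset W x, W `<=` U & forall y, oset W y -> shval s y = germ t y].
Proof. exact: shval_loc. Qed.

Lemma shrep2 F G U (s : shsec F U) (s' : shsec G U) x : oset U x ->
  exists W (t : F W) (t' : G W), [/\ oset W x, W `<=` U &
    forall y, oset W y -> shval s y = germ t y /\ shval s' y = germ t' y].
Proof.
move=> Ux; have [W [t [Wx WU e]]] := shrep s Ux.
have [W' [t' [Wx' WU' e']]] := shrep s' Ux.
exists (openI W W'), (pres (@openIl _ W W') t),
  (pres (@openIr _ W W') t'); split => //.
  by move=> y [/WU].
by move=> y [wy wy']; rewrite !germ_res// e// e'.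
Qed.

Lemma shrep3 F G H U (s : shsec F U) (s' : shsec G U) (s'' : shsec H U) x :
  oset U x -> exists W (t : F W) (t' : G W) (t'' : H W),
  [/\ oset W x, W `<=` U & forall y, oset W y ->
    [/\ shval s y = germ t y, shval s' y = germ t' y & shval s'' y = germ t'' y]].
Proof.
move=> Ux; have [W [t [t' [Wx WU e]]]] := shrep2 s s' Ux.
have [W' [t'' [Wx' WU' e']]] := shrep s'' Ux.
exists (openI W W'), (pres (@openIl _ W W') t),
  (pres (@openIl _ W W') t'),
  (pres (@openIr _ W W') t''); split => //.
  by move=> y [/WU].
by move=> y [wy wy']; rewrite !germ_res//; have [-> ->] := e _ wy; split=> //; exact: e'.
Qed.

Definition sh_unit F U (t : F U) : shsec F U.
Proof.
apply: (@ShSec F U (germ t)) => [x|x Ux]; first exact: germ_out.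
by exists U, t; split.
Defined.

Definition sh_res F U V (h : V `<=` U) (s : shsec F U) : shsec F V.
Proof.
apply: (@ShSec F V (fun x => [set p | oset V x /\ shval s x p])) => [x nx|x Vx].
  by apply/seteqP; split=> // p [].
have [W [t [Wx WU e]]] := shrep s (h _ Vx).
exists (openI W V), (pres (@openIl _ W V) t); split=> //.
  exact: openIr.
move=> y [Wy Vy]; rewrite germ_res// -e//.
by apply/seteqP; split=> // p [].
Defined.

Lemma sh_resE F U V (h : V `<=` U) (s : shsec F U) x :
  oset V x -> shval (sh_res h s) x = shval s x.
Proof. by move=> Vx; apply/seteqP; split=> // p []. Qed.

Definition shpsh F : presheaf X.
Proof.
refine (@Presheaf X (shsec F) (fun U V h => sh_res h) _ _).
- by move=> U h s; apply: shsec_ext => x Ux; rewrite sh_resE.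
- move=> U V W hVU hWV hWU s; apply: shsec_ext => x Wx.
  by rewrite !sh_resE//; exact: hWV.
Defined.

Lemma shpsh_sheaf F : is_sheaf (shpsh F).
Proof.
move=> U C V hV cov; split=> [s t e|s e].
  apply: shsec_ext => x /cov [i _ Vx].
  by rewrite -(sh_resE (hV i))// -[RHS](sh_resE (hV i))//; congr (shval _ x); exact: e.
pose v x := [set p | exists i, oset (V i) x /\ shval (s i) x p].
have vE i x : oset (V i) x -> v x = shval (s i) x.
  move=> Vx; apply/seteqP; split=> p; last by exists i.
  move=> [j [Vjx]].
  have : shval (sh_res (@openIl _ (V i) (V j)) (s i)) x =
         shval (sh_res (@openIr _ (V i) (V j)) (s j)) x.
    by congr (shval _ x); exact: e.
  by rewrite !sh_resE// => ->.
have v0 x : ~ oset U x -> v x = set0.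
  by move=> nx; apply/seteqP; split=> // p [i [/hV]].
have vl x : oset U x -> exists W (t : F W),
    [/\ oset W x, W `<=` U & forall y, oset W y -> v y = germ t y].
  move=> /cov [i _ Vx]; have [W [t [Wx WV et]]] := shrep (s i) Vx.
  exists W, t; split=> // [|y Wy]; first by apply: subset_trans WV (hV i).
  by rewrite (vE i) ?et//; exact: WV.
exists (ShSec v0 vl) => i; apply: shsec_ext => x Vx.
by rewrite sh_resE //= (vE i).
Qed.

Definition natural1 F G (f : forall W, F W -> G W) : Prop :=
  forall W N (h : N `<=` W) s, pres h (f W s) = f N (pres h s).
Definition natural2 F G H (f : forall W, F W -> G W -> H W) : Prop :=
  forall W N (h : N `<=` W) s t, pres h (f W s t) = f N (pres h s) (pres h t).

Definition gop1 F G (f : forall W, F W -> G W) (P : set {W : opens X & F W})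
    (x : X) : set {W : opens X & G W} :=
  [set p | exists W (s : F W), P (existT _ W s) /\ germ (f W s) x p].
Definition gop2 F G H (f : forall W, F W -> G W -> H W)
    (P : set {W : opens X & F W}) (Q : set {W : opens X & G W})
    (x : X) : set {W : opens X & H W} :=
  [set p | exists W (s : F W) (t : G W),
    [/\ P (existT _ W s), Q (existT _ W t) & germ (f W s t) x p]].

Lemma gop1E F G (f : forall W, F W -> G W) (nf : natural1 f) W (s : F W) x :
  oset W x -> gop1 f (germ s x) x = germ (f W s) x.
Proof.
move=> Wx; apply/seteqP; split=> p; last by move=> ?; exists W, s; split=> //; exact: germ_self.
move=> [W' [s' [[N [h1 [h2 [Nx e]]]]]]].
by rewrite (@germ_eq _ _ _ (f W' s') (f W s) N h2 h1)//= !nf e.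
Qed.

Lemma gop2E F G H (f : forall W, F W -> G W -> H W) (nf : natural2 f)
  W (s : F W) (t : G W) x :
  oset W x -> gop2 f (germ s x) (germ t x) x = germ (f W s t) x.
Proof.
move=> Wx; apply/seteqP; split=> p; last first.
  by move=> ?; exists W, s, t; split=> //; exact: germ_self.
move=> [W' [s' [t' [[N [h1 [h2 [/= Nx e]]]] [N' [h1' [h2' [/= Nx' e']]]]]]]].
pose k := subset_trans (@openIl _ N N') h1.
pose k' := subset_trans (@openIl _ N N') h2.
rewrite (@germ_eq _ _ _ (f W' s' t') (f W s t) (openI N N') k' k)//.
rewrite !nf; congr f.
  by rewrite -(pres_comp h1 (@openIl _ N N') k) e pres_comp.
rewrite (Prop_irrelevance k (subset_trans (@openIr _ N N') h1')).
rewrite (Prop_irrelevance k' (subset_trans (@openIr _ N N') h2')).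
rewrite -(pres_comp h1' (@openIr _ N N')) e'.
by rewrite (pres_comp _ _ (subset_trans (@openIr _ N N') h2')).
Qed.

Definition sh1 F G (f : forall W, F W -> G W) (nf : natural1 f) U
  (s : shsec F U) : shsec G U.
Proof.
apply: (@ShSec G U (fun x => [set p | oset U x /\ gop1 f (shval s x) x p])) => [x nx|x Ux].
  by apply/seteqP; split=> // p [].
have [W [t [Wx WU e]]] := shrep s Ux.
exists W, (f W t); split=> // y Wy; rewrite -gop1E// -e//.
by apply/seteqP; split=> // p; [case|split=> //; exact: WU].
Defined.

Definition sh2 F G H (f : forall W, F W -> G W -> H W) (nf : natural2 f) U
  (s : shsec F U) (t : shsec G U) : shsec H U.
Proof.
apply: (@ShSec H U (fun x =>
  [set p | oset U x /\ gop2 f (shval s x) (shval t x) x p])) => [x nx|x Ux].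
  by apply/seteqP; split=> // p [].
have [W [a [b [Wx WU e]]]] := shrep2 s t Ux.
exists W, (f W a b); split=> // y Wy; rewrite -gop2E// -(e _ Wy).1 -(e _ Wy).2.
by apply/seteqP; split=> // p; [case|split=> //; exact: WU].
Defined.

Lemma sh1E F G (f : forall W, F W -> G W) (nf : natural1 f) U (s : shsec F U)
  x W (t : F W) : oset U x -> oset W x -> shval s x = germ t x ->
  shval (sh1 nf s) x = germ (f W t) x.
Proof.
move=> Ux Wx e; rewrite -gop1E// -e.
by apply/seteqP; split=> p; [case|split].
Qed.

Lemma sh2E F G H (f : forall W, F W -> G W -> H W) (nf : natural2 f) U
  (s : shsec F U) (s' : shsec G U) x W (t : F W) (t' : G W) :
  oset U x -> oset W x -> shval s x = germ t x -> shval s' x = germ t' x ->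
  shval (sh2 nf s s') x = germ (f W t t') x.
Proof.
move=> Ux Wx e e'; rewrite -gop2E// -e -e'.
by apply/seteqP; split=> p; [case|split].
Qed.

Lemma sh_unitE F U W (t : F U) (h : W `<=` U) x : oset W x ->
  shval (sh_unit t) x = germ (pres h t) x.
Proof. by move=> Wx; rewrite germ_res. Qed.

End Sheafification.

Section SheafifyZmod.
Variables (X : topologicalType) (F : zpresheaf X).
Let P := psh_of_z F.

Definition shz (U : opens X) : Type := shsec P U.

HB.instance Definition _ U := Choice.on (shz U).

Lemma shz_nat0 : natural1 (fun W (_ : P W) => (0 : F W) : P W).
Proof. by move=> W N h s; apply: raddf0. Qed.
Lemma shz_natN : natural1 (fun W (s : P W) => (- (s : F W)) : P W).
Proof. by move=> W N h s; apply: raddfN. Qed.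
Lemma shz_natD : natural2 (fun W (s t : P W) => ((s : F W) + (t : F W)) : P W).
Proof. by move=> W N h s t; apply: raddfD. Qed.

Definition shz0 U : shz U := sh_unit (F := P) (0 : F U).
Definition shzN U (s : shz U) : shz U := sh1 shz_natN s.
Definition shzD U (s t : shz U) : shz U := sh2 shz_natD s t.

Lemma shz0E U W x : oset U x -> oset W x ->
  shval (shz0 U) x = germ (F := P) (0 : F W) x.
Proof.
move=> Ux Wx; rewrite /= -(germ_res (@openIl _ U W))// -[RHS](germ_res (@openIr _ U W))//.
by rewrite /= !raddf0.
Qed.

Lemma shzDA U : associative (@shzD U).
Proof.
move=> s t u; apply: shsec_ext => x Ux.
have [W [a [b [c [Wx WU e]]]]] := shrep3 s t u Ux; have [ea eb ec] := e _ Wx.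
rewrite (sh2E _ Ux Wx ea (sh2E _ Ux Wx eb ec)).
by rewrite (sh2E _ Ux Wx (sh2E _ Ux Wx ea eb) ec) addrA.
Qed.

Lemma shzDC U : commutative (@shzD U).
Proof.
move=> s t; apply: shsec_ext => x Ux.
have [W [a [b [Wx WU e]]]] := shrep2 s t Ux; have [ea eb] := e _ Wx.
by rewrite (sh2E _ Ux Wx ea eb) (sh2E _ Ux Wx eb ea) addrC.
Qed.

Lemma shz0D U : left_id (shz0 U) (@shzD U).
Proof.
move=> s; apply: shsec_ext => x Ux.
have [W [a [Wx WU e]]] := shrep s Ux.
by rewrite (sh2E _ Ux Wx (shz0E Ux Wx) (e _ Wx)) add0r (e _ Wx).
Qed.

Lemma shzNs U : left_inverse (shz0 U) (@shzN U) (@shzD U).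
Proof.
move=> s; apply: shsec_ext => x Ux.
have [W [a [Wx WU e]]] := shrep s Ux.
rewrite (sh2E _ Ux Wx (sh1E _ Ux Wx (e _ Wx)) (e _ Wx)) addNr.
by rewrite (shz0E Ux Wx).
Qed.

HB.instance Definition _ U :=
  GRing.isZmodule.Build (shz U) (@shzDA U) (@shzDC U) (@shz0D U) (@shzNs U).

Definition shz_res (U V : opens X) (h : V `<=` U) (s : shz U) : shz V :=
  sh_res h s.

Lemma shz_res_additive (U V : opens X) (h : V `<=` U) : zmod_morphism (shz_res h).
Proof.
move=> s t; apply: shsec_ext => x Vx; have Ux := h _ Vx.
have [W [a [b [Wx WU e]]]] := shrep2 s t Ux; have [ea eb] := e _ Wx.
have ea' : shval (shz_res h s) x = germ a x by rewrite sh_resE.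
have eb' : shval (shz_res h t) x = germ b x by rewrite sh_resE.
rewrite sh_resE//.
rewrite (sh2E shz_natD Ux Wx ea (sh1E shz_natN Ux Wx eb)).
by rewrite (sh2E shz_natD Vx Wx ea' (sh1E shz_natN Vx Wx eb')).
Qed.

HB.instance Definition _ (U V : opens X) (h : V `<=` U) :=
  GRing.isZmodMorphism.Build (shz U) (shz V) (shz_res h) (@shz_res_additive U V h).

Definition shz_unit U (s : F U) : shz U := sh_unit (F := P) s.

Lemma shz_unitE (U W : opens X) (s : F U) (h : W `<=` U) x : oset W x ->
  shval (shz_unit s) x = germ (F := P) (zres F h s) x.
Proof. exact: (sh_unitE (F := P) s h). Qed.

Lemma shz_unit_additive U : zmod_morphism (@shz_unit U).
Proof.
move=> s t; apply: shsec_ext => x Ux.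
have es : shval (shz_unit s) x = germ (F := P) s x by [].
have et : shval (shz_unit t) x = germ (F := P) t x by [].
by rewrite (sh2E shz_natD Ux Ux es (sh1E shz_natN Ux Ux et)).
Qed.

HB.instance Definition _ U :=
  GRing.isZmodMorphism.Build (F U) (shz U) (@shz_unit U) (@shz_unit_additive U).

Lemma shz_unit_res (U V : opens X) (h : V `<=` U) (s : F U) :
  shz_res h (shz_unit s) = shz_unit (zres F h s).
Proof. by apply: shsec_ext => x Vx; rewrite sh_resE// (shz_unitE s h). Qed.

End SheafifyZmod.

Section SheafifyRing.
Variables (X : topologicalType) (A : ringPresheaf X).
Let F := z_of_ring A.
Let P := psh_of_z F.

Definition shr (U : opens X) : Type := shz F U.
HB.instance Definition _ U := GRing.Zmodule.on (shr U).

Lemma shr_natM : natural2 (fun W (s t : P W) => ((s : A W) * (t : A W)) : P W).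
Proof. by move=> W N h s t; apply: (rmorphM (rres A h)). Qed.

Definition shrM U (s t : shr U) : shr U := sh2 shr_natM s t.
Definition shr1 U : shr U := shz_unit (F := F) (1 : A U).

Lemma shr1E U W x : oset U x -> oset W x ->
  shval (shr1 U) x = germ (F := P) (1 : A W) x.
Proof.
move=> Ux Wx; rewrite /= -(germ_res (@openIl _ U W))// -[RHS](germ_res (@openIr _ U W))//.
by rewrite /= !rmorph1.
Qed.

Lemma shrMA U : associative (@shrM U).
Proof.
move=> s t u; apply: shsec_ext => x Ux.
have [W [a [b [c [Wx WU e]]]]] := shrep3 s t u Ux; have [ea eb ec] := e _ Wx.
rewrite (sh2E _ Ux Wx ea (sh2E _ Ux Wx eb ec)).
by rewrite (sh2E _ Ux Wx (sh2E _ Ux Wx ea eb) ec) mulrA.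
Qed.

Lemma shr1M U : left_id (shr1 U) (@shrM U).
Proof.
move=> s; apply: shsec_ext => x Ux.
have [W [a [Wx WU e]]] := shrep s Ux.
by rewrite (sh2E _ Ux Wx (shr1E Ux Wx) (e _ Wx)) mul1r (e _ Wx).
Qed.

Lemma shrM1 U : right_id (shr1 U) (@shrM U).
Proof.
move=> s; apply: shsec_ext => x Ux.
have [W [a [Wx WU e]]] := shrep s Ux.
by rewrite (sh2E _ Ux Wx (e _ Wx) (shr1E Ux Wx)) mulr1 (e _ Wx).
Qed.

Lemma shrMDl U : left_distributive (@shrM U) +%R.
Proof.
move=> s t u; apply: shsec_ext => x Ux.
have [W [a [b [c [Wx WU e]]]]] := shrep3 s t u Ux; have [ea eb ec] := e _ Wx.
rewrite (sh2E _ Ux Wx (sh2E (@shz_natD X F) Ux Wx ea eb) ec).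
rewrite (sh2E (@shz_natD X F) Ux Wx (sh2E shr_natM Ux Wx ea ec) (sh2E shr_natM Ux Wx eb ec)).
by rewrite mulrDl.
Qed.

Lemma shrMDr U : right_distributive (@shrM U) +%R.
Proof.
move=> s t u; apply: shsec_ext => x Ux.
have [W [a [b [c [Wx WU e]]]]] := shrep3 s t u Ux; have [ea eb ec] := e _ Wx.
rewrite (sh2E _ Ux Wx ea (sh2E (@shz_natD X F) Ux Wx eb ec)).
rewrite (sh2E (@shz_natD X F) Ux Wx (sh2E shr_natM Ux Wx ea eb) (sh2E shr_natM Ux Wx ea ec)).
by rewrite mulrDr.
Qed.

HB.instance Definition _ U := GRing.Zmodule_isPzRing.Build (shr U)
  (@shrMA U) (@shr1M U) (@shrM1 U) (@shrMDl U) (@shrMDr U).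

Definition shr_res (U V : opens X) (h : V `<=` U) (s : shr U) : shr V :=
  shz_res h s.

Lemma shr_res_monoid (U V : opens X) (h : V `<=` U) : monoid_morphism (shr_res h).
Proof.
split=> [|s t].
  by rewrite /shr_res [LHS]shz_unit_res /= rmorph1.
apply: shsec_ext => x Vx; have Ux := h _ Vx.
have [W [a [b [Wx WU e]]]] := shrep2 s t Ux; have [ea eb] := e _ Wx.
have ea' : shval (shr_res h s) x = germ a x by rewrite sh_resE.
have eb' : shval (shr_res h t) x = germ b x by rewrite sh_resE.
rewrite sh_resE// (sh2E shr_natM Ux Wx ea eb).
by rewrite (sh2E shr_natM Vx Wx ea' eb').
Qed.

HB.instance Definition _ (U V : opens X) (h : V `<=` U) :=
  GRing.isZmodMorphism.Build (shr U) (shr V) (shr_res h)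
    (@shz_res_additive X F U V h).
HB.instance Definition _ (U V : opens X) (h : V `<=` U) :=
  GRing.isMonoidMorphism.Build (shr U) (shr V) (shr_res h) (@shr_res_monoid U V h).

Definition ring_sheafify : ringSheaf X.
Proof.
refine (@RingSheaf X (@RingPresheaf X (fun U => shr U) (fun U V h => shr_res h)
  (@pres_id _ (shpsh P)) (@pres_comp _ (shpsh P))) _).
exact: (@shpsh_sheaf X P).
Defined.

Definition shr_unit U (s : A U) : shr U := shz_unit (F := F) s.

Lemma shr_unit_monoid U : monoid_morphism (@shr_unit U).
Proof.
split=> // s t; apply: shsec_ext => x Ux.
have es : shval (shr_unit s) x = germ (F := P) s x by [].
have et : shval (shr_unit t) x = germ (F := P) t x by [].
by rewrite (sh2E shr_natM Ux Ux es et).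
Qed.

HB.instance Definition _ U :=
  GRing.isZmodMorphism.Build (A U) (shr U) (@shr_unit U) (@shz_unit_additive X F U).
HB.instance Definition _ U :=
  GRing.isMonoidMorphism.Build (A U) (shr U) (@shr_unit U) (@shr_unit_monoid U).

Definition ring_unit : ringHom A ring_sheafify :=
  @RingHom X A ring_sheafify (fun U => @shr_unit U) (@shz_unit_res X F).

End SheafifyRing.

Section SheafifyMod.
Variables (X : topologicalType) (A : ringSheaf X) (M : modPresheaf A).
Let F := z_of_mod M.
Let P := psh_of_z F.
Let R := psh_of_z (z_of_ring A).

Definition shm (U : opens X) : Type := shz F U.
HB.instance Definition _ U := GRing.Zmodule.on (shm U).

Lemma shm_natZ : natural2 (fun W (a : R W) (t : P W) => ((a : A W) *: (t : M W)) : P W).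
Proof. by move=> W N h a t; apply: mresZ. Qed.

Definition shmZ U (a : A U) (s : shm U) : shm U :=
  sh2 shm_natZ (sh_unit (F := R) a) s.

Lemma shmZE (U W : opens X) (a : A U) (s : shm U) (t : M W) (h : W `<=` U) x : oset W x ->
  shval s x = germ (F := P) t x ->
  shval (shmZ a s) x = germ (F := P) (rres A h a *: t) x.
Proof.
move=> Wx et; apply: (sh2E shm_natZ (h _ Wx) Wx _ et).
exact: (sh_unitE (F := R) a h).
Qed.

Lemma shmZA U a b (s : shm U) : shmZ a (shmZ b s) = shmZ (a * b) s.
Proof.
apply: shsec_ext => x Ux; have [W [m [Wx WU e]]] := shrep s Ux.
rewrite (shmZE _ WU Wx (shmZE _ WU Wx (e _ Wx))) (shmZE _ WU Wx (e _ Wx)).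
by rewrite scalerA rmorphM.
Qed.

Lemma shm1Z U : left_id 1 (@shmZ U).
Proof.
move=> s; apply: shsec_ext => x Ux; have [W [m [Wx WU e]]] := shrep s Ux.
by rewrite (shmZE _ WU Wx (e _ Wx)) rmorph1 scale1r (e _ Wx).
Qed.

Lemma shmZDr U : right_distributive (@shmZ U) +%R.
Proof.
move=> a s t; apply: shsec_ext => x Ux.
have [W [m [n [Wx WU e]]]] := shrep2 s t Ux; have [em en] := e _ Wx.
rewrite (shmZE _ WU Wx (sh2E (@shz_natD X F) Ux Wx em en)).
rewrite (sh2E (@shz_natD X F) Ux Wx (shmZE a WU Wx em) (shmZE a WU Wx en)).
by rewrite scalerDr.
Qed.

Lemma shmZDl U (s : shm U) : {morph (@shmZ U)^~ s : a b / a + b}.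
Proof.
move=> a b; apply: shsec_ext => x Ux; have [W [m [Wx WU e]]] := shrep s Ux.
rewrite (shmZE _ WU Wx (e _ Wx)).
rewrite (sh2E (@shz_natD X F) Ux Wx (shmZE a WU Wx (e _ Wx)) (shmZE b WU Wx (e _ Wx))).
by rewrite rmorphD scalerDl.
Qed.

HB.instance Definition _ U := GRing.Zmodule_isLmodule.Build (A U) (shm U)
  (@shmZA U) (@shm1Z U) (@shmZDr U) (@shmZDl U).

Definition shm_res (U V : opens X) (h : V `<=` U) (s : shm U) : shm V :=
  shz_res h s.
HB.instance Definition _ (U V : opens X) (h : V `<=` U) :=
  GRing.isZmodMorphism.Build (shm U) (shm V) (shm_res h)
    (@shz_res_additive X F U V h).

Lemma shm_resZ (U V : opens X) (h : V `<=` U) a (s : shm U) :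
  shm_res h (a *: s) = rres A h a *: shm_res h s.
Proof.
apply: shsec_ext => x Vx; have Ux := h _ Vx.
have [W [m [Wx WU e]]] := shrep s Ux; have em := e _ Wx.
pose N := openI W V.
have em' : shval s x = germ (F := P) (mres M (@openIl _ W V) m) x.
  by rewrite em -(germ_res (@openIl _ W V)).
have em'' : shval (shm_res h s) x = germ (F := P) (mres M (@openIl _ W V) m) x.
  by rewrite sh_resE// em'.
have Nx : oset (openI W V) x by [].
rewrite sh_resE// (shmZE a (subset_trans (@openIr _ W V) h) Nx em').
rewrite (shmZE (rres A h a) (@openIr _ W V) Nx em'').
by rewrite (rres_comp _ _ (subset_trans (@openIr _ W V) h)).
Qed.

Definition mod_sheafify : modSheaf A.
Proof.
refine (@ModSheaf X A (@ModPresheaf X A (fun U => shm U) (fun U V h => shm_res h)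
  shm_resZ (@pres_id _ (shpsh P)) (@pres_comp _ (shpsh P))) _).
exact: (@shpsh_sheaf X P).
Defined.

End SheafifyMod.

Section SheafifyModMap.
Variables (X : topologicalType) (A : ringSheaf X).

Lemma modHom_nat (M N : modPresheaf A) (f : modHom M N) :
  natural1 (F := psh_of_z (z_of_mod M)) (G := psh_of_z (z_of_mod N)) (fun W => f W).
Proof. by move=> W V h s; apply: mhom_res. Qed.

Definition shm_map (M N : modPresheaf A) (f : modHom M N) U (s : shm M U) : shm N U :=
  sh1 (modHom_nat f) s.

Lemma shm_map_linear (M N : modPresheaf A) (f : modHom M N) U :
  linear (@shm_map M N f U).
Proof.
move=> a s t; apply: shsec_ext => x Ux.
have [W [m [n [Wx WU e]]]] := shrep2 s t Ux; have [em en] := e _ Wx.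
have fm := sh1E (modHom_nat f) Ux Wx em; have fn := sh1E (modHom_nat f) Ux Wx en.
rewrite (sh2E (@shz_natD X (z_of_mod N)) Ux Wx (shmZE a WU Wx fm) fn).
rewrite (sh1E (modHom_nat f) Ux Wx (sh2E (@shz_natD X (z_of_mod M)) Ux Wx (shmZE a WU Wx em) en)).
by rewrite linearP.
Qed.

HB.instance Definition _ (M N : modPresheaf A) (f : modHom M N) U :=
  GRing.isLinear.Build (A U) (shm M U) (shm N U) _ (@shm_map M N f U)
    (@shm_map_linear M N f U).

Definition mod_sheafify_map (M N : modPresheaf A) (f : modHom M N) :
  modHom (mod_sheafify M) (mod_sheafify N).
Proof.
refine (@ModHom X A (mod_sheafify M) (mod_sheafify N) (fun U => @shm_map M N f U) _).
move=> U V h s; apply: shsec_ext => x Vx; have Ux := h _ Vx.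
have [W [m [Wx WU e]]] := shrep s Ux; have em := e _ Wx.
rewrite sh_resE// (sh1E _ Ux Wx em).
by rewrite (sh1E _ Vx Wx (_ : _ = germ m x)) // sh_resE.
Defined.

End SheafifyModMap.

Inductive fterm (G : Type) : Type :=
  | F0 | Fgen of G | Fadd of fterm G & fterm G | Fopp of fterm G.
Arguments F0 {G}.

HB.instance Definition _ G := gen_eqMixin (fterm G).
HB.instance Definition _ G := gen_choiceMixin (fterm G).

Section Presented.
Variables (G : Type) (rel : fterm G -> fterm G -> Prop).

(* The least congruence that contains rel and makes fterm G an abelian group. *)
Inductive fcong : fterm G -> fterm G -> Prop :=
  | fcong_rel s t : rel s t -> fcong s t
  | fcong_refl s : fcong s s
  | fcong_sym s t : fcong s t -> fcong t s
  | fcong_trans s t u : fcong s t -> fcong t u -> fcong s u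
  | fcong_add s s' t t' : fcong s s' -> fcong t t' -> fcong (Fadd s t) (Fadd s' t')
  | fcong_opp s s' : fcong s s' -> fcong (Fopp s) (Fopp s')
  | fcong_addA s t u : fcong (Fadd s (Fadd t u)) (Fadd (Fadd s t) u)
  | fcong_addC s t : fcong (Fadd s t) (Fadd t s)
  | fcong_add0 s : fcong (Fadd F0 s) s
  | fcong_addN s : fcong (Fadd (Fopp s) s) F0.

Definition fcongb (s t : fterm G) : bool := `[< fcong s t >].

Lemma fcongb_refl : reflexive fcongb.
Proof. by move=> s; apply/asboolP; apply: fcong_refl. Qed.
Lemma fcongb_sym : symmetric fcongb.
Proof. by move=> s t; apply/asboolP/asboolP; apply: fcong_sym. Qed.
Lemma fcongb_trans : transitive fcongb.
Proof.
by move=> s t u /asboolP h /asboolP k; apply/asboolP; apply: fcong_trans h k.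
Qed.

Canonical fcong_equiv := EquivRel fcongb fcongb_refl fcongb_sym fcongb_trans.

Definition pab : Type := {eq_quot fcong_equiv}.
HB.instance Definition _ := Choice.on pab.
HB.instance Definition _ := EqQuotient.on pab.

Definition pcl (t : fterm G) : pab := \pi_pab t.
Definition pgen (g : G) : pab := pcl (Fgen g).

Lemma pclP s t : pcl s = pcl t <-> fcong s t.
Proof.
split=> [/eqmodP/asboolP//|h]; apply/eqmodP/asboolP; exact: h.
Qed.

Lemma pcl_repr x : pcl (repr x) = x. Proof. exact: reprK. Qed.

Lemma fcong_repr t : fcong (repr (pcl t)) t.
Proof. by apply/pclP; rewrite pcl_repr. Qed.

Definition pab_add (x y : pab) : pab := pcl (Fadd (repr x) (repr y)).
Definition pab_opp (x : pab) : pab := pcl (Fopp (repr x)).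

Lemma pab_addE s t : pab_add (pcl s) (pcl t) = pcl (Fadd s t).
Proof. by apply/pclP; apply: fcong_add; apply: fcong_repr. Qed.
Lemma pab_oppE s : pab_opp (pcl s) = pcl (Fopp s).
Proof. by apply/pclP; apply: fcong_opp; apply: fcong_repr. Qed.

Lemma pab_addA : associative pab_add.
Proof.
move=> x y z; rewrite -(pcl_repr x) -(pcl_repr y) -(pcl_repr z) !pab_addE.
by apply/pclP; apply: fcong_addA.
Qed.
Lemma pab_addC : commutative pab_add.
Proof.
move=> x y; rewrite -(pcl_repr x) -(pcl_repr y) !pab_addE.
by apply/pclP; apply: fcong_addC.
Qed.
Lemma pab_add0 : left_id (pcl F0) pab_add.
Proof.
move=> x; rewrite -(pcl_repr x) !pab_addE.
by apply/pclP; apply: fcong_add0.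
Qed.
Lemma pab_addN : left_inverse (pcl F0) pab_opp pab_add.
Proof.
move=> x; rewrite -(pcl_repr x) pab_oppE !pab_addE.
by apply/pclP; apply: fcong_addN.
Qed.

HB.instance Definition _ :=
  GRing.isZmodule.Build pab pab_addA pab_addC pab_add0 pab_addN.

Lemma pclD s t : pcl (Fadd s t) = pcl s + pcl t.
Proof. by rewrite -pab_addE. Qed.
Lemma pclN s : pcl (Fopp s) = - pcl s.
Proof. by rewrite -pab_oppE. Qed.

Lemma pab_ind (P : pab -> Prop) : P 0 -> (forall x y, P x -> P y -> P (x + y)) ->
  (forall x, P x -> P (- x)) -> (forall g, P (pgen g)) -> forall x, P x.
Proof.
move=> P0 PD PN Pg x; rewrite -(pcl_repr x).
elim: (repr x) => [|g|s Ps t Pt|s Ps]; [exact: P0|exact: Pg| |].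
  by rewrite pclD; apply: PD.
by rewrite pclN; apply: PN.
Qed.

Section Eval.
Variables (Z : zmodType) (f : G -> Z).

Fixpoint feval (t : fterm G) : Z :=
  match t with
  | F0 => 0
  | Fgen g => f g
  | Fadd s t => feval s + feval t
  | Fopp s => - feval s
  end.

Hypothesis frel : forall s t, rel s t -> feval s = feval t.

Lemma feval_cong s t : fcong s t -> feval s = feval t.
Proof.
elim=> //=.
- by move=> {}s {}t u _ -> _ ->.
- by move=> {}s s' {}t t' _ -> _ ->.
- by move=> {}s s' _ ->.
- by move=> *; rewrite addrA.
- by move=> *; rewrite addrC.
- by move=> *; rewrite add0r.
- by move=> *; rewrite addNr.
Qed.

Definition pext of (forall s t, rel s t -> feval s = feval t) :=
  fun x : pab => feval (repr x).

Lemma pext_pcl t : pext frel (pcl t) = feval t.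
Proof. by apply: feval_cong; apply: fcong_repr. Qed.

Lemma pext_gen g : pext frel (pgen g) = f g.
Proof. exact: pext_pcl. Qed.

End Eval.

Lemma pext_additive (Z : zmodType) (f : G -> Z) frel : zmod_morphism (@pext Z f frel).
Proof.
move=> x y; rewrite -(pcl_repr x) -(pcl_repr y) -pclN -pclD.
by rewrite !pext_pcl /= -!pext_pcl.
Qed.

HB.instance Definition _ (Z : zmodType) (f : G -> Z) frel :=
  GRing.isZmodMorphism.Build pab Z (@pext Z f frel) (@pext_additive Z f frel).

Lemma additive_pab_ext (Z : zmodType) (f g : {additive pab -> Z}) :
  (forall a, f (pgen a) = g (pgen a)) -> f =1 g.
Proof.
move=> fg; apply: pab_ind => [|x y ex ey|x ex|//]; first by rewrite !raddf0.
- by rewrite !raddfD ex ey.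
- by rewrite !raddfN ex.
Qed.

End Presented.

Arguments pgen {G rel} g.

Inductive tens_rel (R : pzRingType) (M V : lmodType R) :
    fterm (M * V) -> fterm (M * V) -> Prop :=
  | tens_Dl m m' v :
      tens_rel (Fgen (m + m', v)) (Fadd (Fgen (m, v)) (Fgen (m', v)))
  | tens_Dr m v v' :
      tens_rel (Fgen (m, v + v')) (Fadd (Fgen (m, v)) (Fgen (m, v')))
  | tens_bal a m v : tens_rel (Fgen (a *: m, v)) (Fgen (m, a *: v)).

(* The argument cR is only used by the R-module structure. *)
Definition tens (R : pzRingType) (cR : forall a b : R, a * b = b * a)
  (M V : lmodType R) : Type := pab (@tens_rel R M V).

Section Pure.
Variables (R : pzRingType) (cR : forall a b : R, a * b = b * a) (M V : lmodType R).

HB.instance Definition _ := GRing.Zmodule.on (tens cR M V).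

Definition pure (m : M) (v : V) : tens cR M V := pgen (m, v).

Lemma pureDl m m' v : pure (m + m') v = pure m v + pure m' v.
Proof.
by rewrite /pure /pgen -[RHS]pclD; apply/pclP; apply: fcong_rel; apply: tens_Dl.
Qed.
Lemma pureDr m v v' : pure m (v + v') = pure m v + pure m v'.
Proof.
by rewrite /pure /pgen -[RHS]pclD; apply/pclP; apply: fcong_rel; apply: tens_Dr.
Qed.
Lemma pure_bal a m v : pure (a *: m) v = pure m (a *: v).
Proof. by apply/pclP; apply: fcong_rel; apply: tens_bal. Qed.

Lemma tens_ext (Z : zmodType) (f g : {additive tens cR M V -> Z}) :
  (forall m v, f (pure m v) = g (pure m v)) -> f =1 g.
Proof. by move=> fg; apply: additive_pab_ext => -[m v]; apply: fg. Qed.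

End Pure.

Section Map.
Variables (R S : pzRingType) (cR : forall a b : R, a * b = b * a)
  (cS : forall a b : S, a * b = b * a) (phi : R -> S).
Variables (M V : lmodType R) (M' V' : lmodType S).
Variables (f : {additive M -> M'}) (g : {additive V -> V'}).
Hypothesis fZ : forall a m, f (a *: m) = phi a *: f m.
Hypothesis gZ : forall a v, g (a *: v) = phi a *: g v.

Lemma tens_map_rel s t : @tens_rel R M V s t ->
  feval (fun p : M * V => pure cS (f p.1) (g p.2) : tens cS M' V') s =
  feval (fun p : M * V => pure cS (f p.1) (g p.2) : tens cS M' V') t.
Proof.
case=> [m m' v|m v v'|a m v] /=.
- by rewrite raddfD pureDl.
- by rewrite raddfD pureDr.
- by rewrite fZ gZ pure_bal.
Qed.

Definition tens_map : tens cR M V -> tens cS M' V' := pext tens_map_rel.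

HB.instance Definition _ := GRing.isZmodMorphism.Build (tens cR M V) (tens cS M' V')
  tens_map (pext_additive tens_map_rel).

Lemma tens_map_pure m v : tens_map (pure cR m v) = pure cS (f m) (g v).
Proof. exact: pext_gen. Qed.

End Map.
Arguments tens_map {R S cR cS phi M V M' V' f g} fZ gZ _.

Section Scale.
Variables (R : pzRingType) (cR : forall a b : R, a * b = b * a).
Variables (M V : lmodType R).

Lemma tens_scale_lin (a b : R) (m : M) : a *: (b *: m) = b *: (a *: m).
Proof. by rewrite !scalerA cR. Qed.

Definition tensZ (a : R) : tens cR M V -> tens cR M V :=
  @tens_map R R cR cR id M V M V (GRing.scale a) idfun
    (tens_scale_lin a) (fun _ _ => erefl).

HB.instance Definition _ a := GRing.isZmodMorphism.Build (tens cR M V) (tens cR M V)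
  (tensZ a) (pext_additive (tens_map_rel _ _ _)).

Lemma tensZ_pure a m v : tensZ a (pure cR m v) = pure cR (a *: m) v.
Proof. exact: tens_map_pure. Qed.

Lemma tensZA a b x : tensZ a (tensZ b x) = tensZ (a * b) x.
Proof.
apply: (@tens_ext _ _ _ _ _ (tensZ a \o tensZ b) (tensZ (a * b))) => m v /=.
by rewrite !tensZ_pure scalerA.
Qed.
Lemma tens1Z : left_id 1 tensZ.
Proof.
apply: (@tens_ext _ _ _ _ _ (tensZ 1) idfun) => m v /=.
by rewrite !tensZ_pure scale1r.
Qed.
Lemma tensZDr : right_distributive tensZ +%R.
Proof. by move=> a x y; exact: raddfD. Qed.
Lemma tensZDl x : {morph tensZ^~ x : a b / a + b}.
Proof.
move=> a b; apply: (@tens_ext _ _ _ _ _ (tensZ (a + b)) (tensZ a \+ tensZ b)) => m v /=.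
by rewrite !tensZ_pure scalerDl pureDl.
Qed.

HB.instance Definition _ := GRing.Zmodule_isLmodule.Build R (tens cR M V)
  tensZA tens1Z tensZDr tensZDl.

End Scale.

Record bimod (B : pzRingType) := Bimod {
  bmod :> zmodType;
  bl : B -> bmod -> bmod;
  br : bmod -> B -> bmod;
  blDl : forall a b m, bl (a + b) m = bl a m + bl b m;
  blDr : forall a m n, bl a (m + n) = bl a m + bl a n;
  bl1 : forall m, bl 1 m = m;
  blA : forall a b m, bl a (bl b m) = bl (a * b) m;
  brDl : forall m n a, br (m + n) a = br m a + br n a;
  brDr : forall m a b, br m (a + b) = br m a + br m b;
  br1 : forall m, br m 1 = m;
  brA : forall m a b, br (br m a) b = br m (a * b);
  blr : forall a m b, br (bl a m) b = bl a (br m b) }.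

Section TensorAlgebra.
Variables (B : pzRingType) (M : bimod B).

(* TM m1 (.. (TM mn (TB b))) stands for the pure tensor m1 (x) .. (x) mn (x) b of
   M (x)_B .. (x)_B M (x)_B B, that is of the n-th tensor power of M over B; for
   n = 0 this is B itself. *)
Inductive tword : Type := TB of B | TM of M & tword.

Definition tact (b : B) (w : tword) : tword :=
  match w with TB c => TB (b * c) | TM m w' => TM (bl b m) w' end.

Fixpoint tcat (u w : tword) : tword :=
  match u with TB b => tact b w | TM m u' => TM m (tcat u' w) end.

Definition tpre (p : seq M) (w : tword) : tword := foldr TM w p.

(* Multi-additivity and B-balancedness of pure tensors. The relators are
   homogeneous, so the group they present is the direct sum of the tensor powers. *)
Inductive talg_rel : fterm tword -> fterm tword -> Prop :=
  | talg_DB p b b' : talg_rel (Fgen (tpre p (TB (b + b'))))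
      (Fadd (Fgen (tpre p (TB b))) (Fgen (tpre p (TB b'))))
  | talg_DM p m m' w : talg_rel (Fgen (tpre p (TM (m + m') w)))
      (Fadd (Fgen (tpre p (TM m w))) (Fgen (tpre p (TM m' w))))
  | talg_bal p m b w :
      talg_rel (Fgen (tpre p (TM (br m b) w))) (Fgen (tpre p (TM m (tact b w)))).

Definition talg : Type := pab talg_rel.
HB.instance Definition _ := GRing.Zmodule.on talg.

Definition tgen (w : tword) : talg := pgen w.

Lemma tgenDB p b b' : tgen (tpre p (TB (b + b'))) = tgen (tpre p (TB b)) + tgen (tpre p (TB b')).
Proof.
by rewrite /tgen /pgen -[RHS]pclD; apply/pclP; apply: fcong_rel; apply: talg_DB.
Qed.
Lemma tgenDM p m m' w :
  tgen (tpre p (TM (m + m') w)) = tgen (tpre p (TM m w)) + tgen (tpre p (TM m' w)).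
Proof.
by rewrite /tgen /pgen -[RHS]pclD; apply/pclP; apply: fcong_rel; apply: talg_DM.
Qed.
Lemma tgen_bal p m b w : tgen (tpre p (TM (br m b) w)) = tgen (tpre p (TM m (tact b w))).
Proof. by apply/pclP; apply: fcong_rel; apply: talg_bal. Qed.

Lemma talg_ext (Z : zmodType) (f g : {additive talg -> Z}) :
  (forall w, f (tgen w) = g (tgen w)) -> f =1 g.
Proof. exact: additive_pab_ext. Qed.

Lemma tact1 w : tact 1 w = w.
Proof. by case: w => [b|m w] /=; rewrite ?mul1r ?bl1. Qed.
Lemma tactA a b w : tact a (tact b w) = tact (a * b) w.
Proof. by case: w => [c|m w] /=; rewrite ?mulrA ?blA. Qed.
Lemma tact_cat a u w : tact a (tcat u w) = tcat (tact a u) w.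
Proof. by case: u => [b|m u] //=; rewrite tactA. Qed.
Lemma tcatA u v w : tcat u (tcat v w) = tcat (tcat u v) w.
Proof. by elim: u => [b|m u IH] /=; [rewrite tact_cat|rewrite IH]. Qed.
Lemma tcat1 w : tcat w (TB 1) = w.
Proof. by elim: w => [b|m w IH] /=; rewrite ?mulr1 ?IH. Qed.
Lemma tcat_pre p u w : tcat (tpre p u) w = tpre p (tcat u w).
Proof. by elim: p => //= m p ->. Qed.

Lemma tcat_prel u : exists p b, forall w, tcat u w = tpre p (tact b w).
Proof.
elim: u => [b|m u [p [b e]]]; first by exists [::], b.
by exists (m :: p), b => w /=; rewrite e.
Qed.

Lemma tact_pre b m p w : tact b (tpre (m :: p) w) = tpre (bl b m :: p) w.
Proof. by []. Qed.

Lemma tpre_cat p q w : tpre p (tpre q w) = tpre (p ++ q) w.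
Proof. by rewrite /tpre foldr_cat. Qed.

Lemma tmulw_rel (u : tword) s t : talg_rel s t ->
  feval (fun w => tgen (tcat u w)) s = feval (fun w => tgen (tcat u w)) t.
Proof.
have [p [a e]] := tcat_prel u.
case=> [[|n q] b b'|[|n q] m m' w|[|n q] m b w]; cbn [feval]; rewrite !e.
- by rewrite /= mulrDr tgenDB.
- by rewrite !tact_pre !tpre_cat tgenDB.
- by rewrite /= blDr tgenDM.
- by rewrite !tact_pre !tpre_cat tgenDM.
- by rewrite /= -blr tgen_bal.
- by rewrite !tact_pre !tpre_cat tgen_bal.
Qed.

Definition tmulw (u : tword) : talg -> talg := pext (tmulw_rel u).
HB.instance Definition _ u := GRing.isZmodMorphism.Build talg talg (tmulw u)
  (pext_additive (tmulw_rel u)).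

Lemma tmulw_gen u w : tmulw u (tgen w) = tgen (tcat u w).
Proof. exact: pext_gen. Qed.

Lemma tmul_rel (y : talg) s t : talg_rel s t ->
  feval (fun u => tmulw u y) s = feval (fun u => tmulw u y) t.
Proof.
case=> [p b b'|p m m' w|p m b w] /=.
- apply: (@talg_ext _ (tmulw _) (tmulw _ \+ tmulw _)) => v /=.
  rewrite !tmulw_gen !tcat_pre /=; case: v => [c|n v] /=.
    by rewrite mulrDl tgenDB.
  by rewrite blDl tgenDM.
- apply: (@talg_ext _ (tmulw _) (tmulw _ \+ tmulw _)) => v /=.
  by rewrite !tmulw_gen !tcat_pre /= tgenDM.
- apply: (@talg_ext _ (tmulw _) (tmulw _)) => v /=.
  by rewrite !tmulw_gen !tcat_pre /= tgen_bal tact_cat.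
Qed.

Definition tmul (x y : talg) : talg := pext (tmul_rel y) x.

Lemma tmul_gen u w : tmul (tgen u) (tgen w) = tgen (tcat u w).
Proof. by rewrite [LHS]pext_gen tmulw_gen. Qed.

Lemma tmul_genl u y : tmul (tgen u) y = tmulw u y.
Proof. exact: pext_gen. Qed.

Lemma tmulDl : left_distributive tmul +%R.
Proof. by move=> x y z; exact: (raddfD (pext (tmul_rel z))). Qed.

Lemma tmulNl x y : tmul (- x) y = - tmul x y.
Proof. exact: (raddfN (pext (tmul_rel y))). Qed.

Lemma tmul0l y : tmul 0 y = 0.
Proof. exact: (raddf0 (pext (tmul_rel y))). Qed.

Lemma talg_ind (P : talg -> Prop) : P 0 -> (forall x y, P x -> P y -> P (x + y)) ->
  (forall x, P x -> P (- x)) -> (forall w, P (tgen w)) -> forall x, P x.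
Proof. exact: pab_ind. Qed.

Lemma tmulDr : right_distributive tmul +%R.
Proof.
move=> x y z; elim/talg_ind: x => [|x x' ex ex'|x ex|w].
- by rewrite !tmul0l addr0.
- by rewrite !tmulDl ex ex' addrACA.
- by rewrite !tmulNl ex opprD.
- by rewrite !tmul_genl raddfD.
Qed.

Lemma tmul0r x : tmul x 0 = 0.
Proof. by apply: (addrI (tmul x 0)); rewrite -tmulDr !addr0. Qed.

Lemma tmulNr x y : tmul x (- y) = - tmul x y.
Proof. by apply: (addrI (tmul x y)); rewrite -tmulDr !subrr tmul0r. Qed.

Lemma tmulA : associative tmul.
Proof.
move=> x y z; elim/talg_ind: x => [|x x' ex ex'|x ex|u].
- by rewrite !tmul0l.
- by rewrite !tmulDl ex ex'.
- by rewrite !tmulNl ex.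
elim/talg_ind: y => [|y y' ey ey'|y ey|v].
- by rewrite !(tmul0l, tmul0r).
- by rewrite !(tmulDl, tmulDr) ey ey'.
- by rewrite !(tmulNl, tmulNr) ey.
elim/talg_ind: z => [|z z' ez ez'|z ez|w].
- by rewrite !tmul0r.
- by rewrite !tmulDr ez ez'.
- by rewrite !tmulNr ez.
by rewrite !tmul_gen tcatA.
Qed.

Lemma tmul1l : left_id (tgen (TB 1)) tmul.
Proof.
move=> x; elim/talg_ind: x => [|x y ex ey|x ex|w].
- by rewrite tmul0r.
- by rewrite tmulDr ex ey.
- by rewrite tmulNr ex.
- by rewrite tmul_gen /= tact1.
Qed.

Lemma tmul1r : right_id (tgen (TB 1)) tmul.
Proof.
move=> x; elim/talg_ind: x => [|x y ex ey|x ex|w].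
- by rewrite tmul0l.
- by rewrite tmulDl ex ey.
- by rewrite tmulNl ex.
- by rewrite tmul_gen /= tcat1.
Qed.

HB.instance Definition _ := GRing.Zmodule_isPzRing.Build talg
  tmulA tmul1l tmul1r tmulDl tmulDr.

End TensorAlgebra.

Section TensorAlgebraMap.
Variables (B B' : pzRingType) (M : bimod B) (M' : bimod B').
Variables (phi : {rmorphism B -> B'}) (f : {additive M -> M'}).
Hypothesis fl : forall b m, f (bl b m) = bl (phi b) (f m).
Hypothesis fr : forall m b, f (br m b) = br (f m) (phi b).

Fixpoint twmap (w : tword M) : tword M' :=
  match w with TB b => TB M' (phi b) | TM m w' => TM (f m) (twmap w') end.

Lemma twmap_pre p w : twmap (tpre p w) = tpre (map f p) (twmap w).
Proof. by elim: p => //= m p ->. Qed.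
Lemma twmap_act b w : twmap (tact b w) = tact (phi b) (twmap w).
Proof. by case: w => [c|m w] /=; rewrite ?rmorphM ?fl. Qed.
Lemma twmap_cat u w : twmap (tcat u w) = tcat (twmap u) (twmap w).
Proof. by elim: u => [b|m u IH] /=; rewrite ?twmap_act ?IH. Qed.

Lemma talg_map_rel s t : @talg_rel B M s t ->
  feval (fun w => tgen (twmap w)) s = feval (fun w => tgen (twmap w)) t.
Proof.
case=> [p b b'|p m m' w|p m b w] /=; rewrite !twmap_pre /=.
- by rewrite rmorphD tgenDB.
- by rewrite raddfD tgenDM.
- by rewrite fr tgen_bal twmap_act.
Qed.

Definition talg_map : talg M -> talg M' := pext talg_map_rel.
HB.instance Definition _ := GRing.isZmodMorphism.Build (talg M) (talg M') talg_map
  (pext_additive talg_map_rel).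

Lemma talg_map_gen w : talg_map (tgen w) = tgen (twmap w).
Proof. exact: pext_gen. Qed.

Lemma talg_map_monoid : monoid_morphism talg_map.
Proof.
split=> [|x y]; first by rewrite [LHS]talg_map_gen /= rmorph1.
elim/talg_ind: x => [|x x' ex ex'|x ex|u].
- by rewrite mul0r raddf0 mul0r.
- by rewrite mulrDl !raddfD /= ex ex' mulrDl.
- by rewrite mulNr !raddfN /= ex mulNr.
elim/talg_ind: y => [|y y' ey ey'|y ey|v].
- by rewrite mulr0 raddf0 mulr0.
- by rewrite mulrDr !raddfD /= ey ey' mulrDr.
- by rewrite mulrN !raddfN /= ey mulrN.
rewrite [_ * _ in LHS]tmul_gen !talg_map_gen [RHS]tmul_gen.
by rewrite twmap_cat.
Qed.
HB.instance Definition _ := GRing.isMonoidMorphism.Build (talg M) (talg M') talg_map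
  talg_map_monoid.

End TensorAlgebraMap.

Record two_sided (R : pzRingType) (I : set R) : Prop := TwoSided {
  ts0 : I 0;
  tsB : forall a b, I a -> I b -> I (a - b);
  tsMl : forall a b, I b -> I (a * b);
  tsMr : forall a b, I a -> I (a * b) }.

Section QuotientRing.
Variables (R : pzRingType) (I : set R) (hI : two_sided I).

Lemma tsN a : I a -> I (- a).
Proof. by move=> Ia; rewrite -sub0r; apply: (tsB hI) => //; apply: (ts0 hI). Qed.
Lemma tsD a b : I a -> I b -> I (a + b).
Proof. by move=> Ia Ib; rewrite -[b]opprK; apply: (tsB hI) => //; apply: tsN. Qed.

Definition qeq of two_sided I := fun a b : R => `[< I (a - b) >].

Lemma qeq_refl : reflexive (qeq hI).
Proof. by move=> a; apply/asboolP; rewrite subrr; apply: (ts0 hI). Qed.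
Lemma qeq_sym : symmetric (qeq hI).
Proof. by move=> a b; apply/asboolP/asboolP => /tsN; rewrite opprB. Qed.
Lemma qeq_trans : transitive (qeq hI).
Proof.
move=> b a c /asboolP h /asboolP k; apply/asboolP.
by have := tsD h k; rewrite addrA subrK.
Qed.

Canonical qeq_equiv := EquivRel (qeq hI) qeq_refl qeq_sym qeq_trans.

Definition qring : Type := {eq_quot qeq_equiv}.
HB.instance Definition _ := Choice.on qring.
HB.instance Definition _ := EqQuotient.on qring.

Definition qcl (a : R) : qring := \pi_qring a.

Lemma qclP a b : qcl a = qcl b <-> I (a - b).
Proof. by split=> [/eqmodP/asboolP//|h]; apply/eqmodP/asboolP. Qed.

Lemma qcl_repr x : qcl (repr x) = x. Proof. exact: reprK. Qed.

Lemma repr_qcl a : I (repr (qcl a) - a).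
Proof. by apply/qclP; rewrite qcl_repr. Qed.

Definition q_add (x y : qring) : qring := qcl (repr x + repr y).
Definition q_opp (x : qring) : qring := qcl (- repr x).
Definition q_mul (x y : qring) : qring := qcl (repr x * repr y).

Lemma q_addE a b : q_add (qcl a) (qcl b) = qcl (a + b).
Proof.
by apply/qclP; rewrite opprD addrACA; apply: tsD; apply: repr_qcl.
Qed.
Lemma q_oppE a : q_opp (qcl a) = qcl (- a).
Proof. by apply/qclP; rewrite -opprD; apply: tsN; apply: repr_qcl. Qed.
Lemma q_mulE a b : q_mul (qcl a) (qcl b) = qcl (a * b).
Proof.
apply/qclP.
have -> : repr (qcl a) * repr (qcl b) - a * b =
    (repr (qcl a) - a) * repr (qcl b) + a * (repr (qcl b) - b).
  by rewrite mulrBl mulrBr addrA subrK.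
by apply: tsD; [apply: (tsMr hI)|apply: (tsMl hI)]; apply: repr_qcl.
Qed.

Lemma qring_ind (P : qring -> Prop) : (forall a, P (qcl a)) -> forall x, P x.
Proof. by move=> h x; rewrite -(qcl_repr x). Qed.

Lemma q_addA : associative q_add.
Proof.
by elim/qring_ind=> a; elim/qring_ind=> b; elim/qring_ind=> c; rewrite !q_addE addrA.
Qed.
Lemma q_addC : commutative q_add.
Proof. by elim/qring_ind=> a; elim/qring_ind=> b; rewrite !q_addE addrC. Qed.
Lemma q_add0 : left_id (qcl 0) q_add.
Proof. by elim/qring_ind=> a; rewrite !q_addE add0r. Qed.
Lemma q_addN : left_inverse (qcl 0) q_opp q_add.
Proof. by elim/qring_ind=> a; rewrite q_oppE !q_addE addNr. Qed.

HB.instance Definition _ := GRing.isZmodule.Build qring q_addA q_addC q_add0 q_addN.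

Lemma qclD a b : qcl (a + b) = qcl a + qcl b.
Proof. by rewrite -q_addE. Qed.

Lemma q_mulA : associative q_mul.
Proof.
by elim/qring_ind=> a; elim/qring_ind=> b; elim/qring_ind=> c; rewrite !q_mulE mulrA.
Qed.
Lemma q_mul1l : left_id (qcl 1) q_mul.
Proof. by elim/qring_ind=> a; rewrite !q_mulE mul1r. Qed.
Lemma q_mul1r : right_id (qcl 1) q_mul.
Proof. by elim/qring_ind=> a; rewrite !q_mulE mulr1. Qed.
Lemma q_mulDl : left_distributive q_mul +%R.
Proof.
by elim/qring_ind=> a; elim/qring_ind=> b; elim/qring_ind=> c;
  rewrite -qclD !q_mulE mulrDl qclD.
Qed.
Lemma q_mulDr : right_distributive q_mul +%R.
Proof.
by elim/qring_ind=> a; elim/qring_ind=> b; elim/qring_ind=> c;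
  rewrite -qclD !q_mulE mulrDr qclD.
Qed.

HB.instance Definition _ := GRing.Zmodule_isPzRing.Build qring
  q_mulA q_mul1l q_mul1r q_mulDl q_mulDr.

Lemma qcl_additive : zmod_morphism qcl.
Proof. by move=> a b; rewrite qclD -q_oppE. Qed.
Lemma qcl_monoid : monoid_morphism qcl.
Proof. by split=> // a b; rewrite -q_mulE. Qed.
HB.instance Definition _ := GRing.isZmodMorphism.Build R qring qcl qcl_additive.
HB.instance Definition _ := GRing.isMonoidMorphism.Build R qring qcl qcl_monoid.

End QuotientRing.

Section QuotientRingMap.
Variables (R S : pzRingType) (I : set R) (J : set S).
Variables (hI : two_sided I) (hJ : two_sided J) (phi : {rmorphism R -> S}).
Hypothesis phiI : forall a, I a -> J (phi a).

Definition qring_map of (forall a, I a -> J (phi a)) :=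
  fun x : qring hI => qcl hJ (phi (repr x)).

Lemma qring_map_cl a : qring_map phiI (qcl hI a) = qcl hJ (phi a).
Proof. by apply/qclP; rewrite -rmorphB; apply: phiI; apply: repr_qcl. Qed.

Lemma qring_map_additive : zmod_morphism (qring_map phiI).
Proof.
elim/qring_ind=> a; elim/qring_ind=> b.
by rewrite -(rmorphB (qcl hI)) !qring_map_cl -(rmorphB (qcl hJ)) rmorphB.
Qed.
Lemma qring_map_monoid : monoid_morphism (qring_map phiI).
Proof.
split; first by rewrite [LHS]qring_map_cl rmorph1.
elim/qring_ind=> a; elim/qring_ind=> b.
by rewrite -(rmorphM (qcl hI)) !qring_map_cl -(rmorphM (qcl hJ)) rmorphM.
Qed.
HB.instance Definition _ := GRing.isZmodMorphism.Build (qring hI) (qring hJ)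
  (qring_map phiI) qring_map_additive.
HB.instance Definition _ := GRing.isMonoidMorphism.Build (qring hI) (qring hJ)
  (qring_map phiI) qring_map_monoid.

End QuotientRingMap.
Arguments qring_map {R S I J hI hJ phi} phiI _ : rename.

Section TensorSheaf.
Variables (X : topologicalType) (O : comRingSheaf X).

Section TensorPresheaf.
Variables (M V : modPresheaf O).

Definition tens_sec (U : opens X) : lmodType (O U) :=
  tens (@com_mulC X O U) (M U) (V U).

Definition tens_res (U W : opens X) (h : W `<=` U) : tens_sec U -> tens_sec W :=
  tens_map (mresZ (m := M) h) (mresZ (m := V) h).

HB.instance Definition _ U W h := GRing.isZmodMorphism.Build (tens_sec U) (tens_sec W)
  (@tens_res U W h) (pext_additive (tens_map_rel _ _ _)).

Lemma tens_res_pure (U W : opens X) (h : W `<=` U) m v :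
  tens_res h (pure _ m v) = pure _ (mres M h m) (mres V h v).
Proof. exact: tens_map_pure. Qed.

Lemma tens_resZ (U W : opens X) (h : W `<=` U) (a : O U) s :
  tens_res h (a *: s) = rres O h a *: tens_res h s.
Proof.
apply: (@tens_ext _ _ _ _ _ (tens_res h \o tensZ a) (tensZ (rres O h a) \o tens_res h)) => m v /=.
by rewrite tensZ_pure !tens_res_pure tensZ_pure mresZ.
Qed.

Lemma tens_res_id (U : opens X) (h : U `<=` U) s : tens_res h s = s.
Proof.
apply: (@tens_ext _ _ _ _ _ (tens_res h) idfun) => m v /=.
by rewrite tens_res_pure !mres_id.
Qed.

Lemma tens_res_comp (U V' W : opens X) (hVU : V' `<=` U) (hWV : W `<=` V')
  (hWU : W `<=` U) s : tens_res hWV (tens_res hVU s) = tens_res hWU s.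
Proof.
apply: (@tens_ext _ _ _ _ _ (tens_res hWV \o tens_res hVU) (tens_res hWU)) => m v /=.
by rewrite !tens_res_pure (mres_comp _ _ hWU) (mres_comp _ _ hWU).
Qed.

Definition tens_psh : modPresheaf O :=
  @ModPresheaf X O tens_sec (fun U W h => tens_res h) tens_resZ tens_res_id tens_res_comp.

End TensorPresheaf.

Section TensorPresheafMap.
Variables (M M' V V' : modPresheaf O) (f : modHom M M') (g : modHom V V').

Definition tens_psh_fun (U : opens X) : tens_psh M V U -> tens_psh M' V' U :=
  tens_map (phi := id) (linearZZ (f U)) (linearZZ (g U)).

HB.instance Definition _ U := GRing.isZmodMorphism.Build (tens_psh M V U)
  (tens_psh M' V' U) (@tens_psh_fun U) (pext_additive (tens_map_rel _ _ _)).

Lemma tens_psh_fun_pure U m v :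
  @tens_psh_fun U (pure _ m v) = pure _ (f U m) (g U v).
Proof. exact: tens_map_pure. Qed.

Lemma tens_psh_fun_scalable U : scalable (@tens_psh_fun U).
Proof.
move=> a s.
apply: (@tens_ext _ _ _ _ _ (@tens_psh_fun U \o tensZ a) (tensZ a \o @tens_psh_fun U)) => m v /=.
by rewrite tensZ_pure !tens_psh_fun_pure tensZ_pure linearZ.
Qed.

HB.instance Definition _ U := GRing.isScalable.Build (O U) (tens_psh M V U)
  (tens_psh M' V' U) _ (@tens_psh_fun U) (@tens_psh_fun_scalable U).

Definition tens_psh_map : modHom (tens_psh M V) (tens_psh M' V').
Proof.
refine (@ModHom X O (tens_psh M V) (tens_psh M' V') (fun U => @tens_psh_fun U) _).
move=> U W h s.
apply: (@tens_ext _ _ _ _ _ (tens_res h \o @tens_psh_fun U) (@tens_psh_fun W \o tens_res h)) => m v /=.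
by rewrite tens_res_pure !tens_psh_fun_pure tens_res_pure !mhom_res.
Defined.

End TensorPresheafMap.

Definition tensor (M V : modSheaf O) : modSheaf O := mod_sheafify (tens_psh M V).

Definition tensor_map (M M' V V' : modSheaf O) (f : modHom M M') (g : modHom V V') :
  modHom (tensor M V) (tensor M' V') := mod_sheafify_map (tens_psh_map f g).

Lemma tensor_map_id (M V : modSheaf O) :
  tensor_map (modHom_id M) (modHom_id V) = modHom_id (tensor M V).
Proof.
apply: modHom_ext => U s; apply: shsec_ext => x Ux.
have [W [m [Wx WU e]]] := shrep s Ux.
rewrite (sh1E _ Ux Wx (e _ Wx)) (e _ Wx) /=.
congr (germ (F := psh_of_z (z_of_mod (tens_psh M V))) _ x).
by apply: (@tens_ext _ _ _ _ _ (@tens_psh_fun _ _ _ _ _ _ W) idfun) => p v /=;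
  rewrite tens_psh_fun_pure.
Qed.

Lemma tensor_map_comp (M M' M'' V V' V'' : modSheaf O)
  (f' : modHom M' M'') (f : modHom M M') (g' : modHom V' V'') (g : modHom V V') :
  tensor_map (modHom_comp f' f) (modHom_comp g' g) =
  modHom_comp (tensor_map f' g') (tensor_map f g).
Proof.
apply: modHom_ext => U s; apply: shsec_ext => x Ux.
have [W [m [Wx WU e]]] := shrep s Ux.
rewrite (sh1E _ Ux Wx (e _ Wx)) (sh1E _ Ux Wx (sh1E _ Ux Wx (e _ Wx))) /=.
congr (germ (F := psh_of_z (z_of_mod (tens_psh M'' V''))) _ x).
by apply: (@tens_ext _ _ _ _ _ (@tens_psh_fun _ _ _ _ _ _ W)
  (@tens_psh_fun _ _ _ _ _ _ W \o @tens_psh_fun _ _ _ _ _ _ W)) => p v /=;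
  rewrite !tens_psh_fun_pure.
Qed.

End TensorSheaf.

Section TensorAlgebraSheaf.
Variables (X : topologicalType) (B : ringPresheaf X).

Record bimodPresheaf := BimodPresheaf {
  bmsec :> forall U : opens X, bimod (B U);
  bmres : forall U V : opens X, V `<=` U -> {additive bmsec U -> bmsec V};
  bmres_l : forall (U V : opens X) (h : V `<=` U) b m,
    bmres h (bl b m) = bl (rres B h b) (bmres h m);
  bmres_r : forall (U V : opens X) (h : V `<=` U) m b,
    bmres h (br m b) = br (bmres h m) (rres B h b);
  bmres_id : forall (U : opens X) (h : U `<=` U) m, bmres h m = m;
  bmres_comp : forall (U V W : opens X) (hVU : V `<=` U) (hWV : W `<=` V)
    (hWU : W `<=` U) m, bmres hWV (bmres hVU m) = bmres hWU m }.

Variable M : bimodPresheaf.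

Definition talg_res (U V : opens X) (h : V `<=` U) : talg (M U) -> talg (M V) :=
  talg_map (@bmres_l M U V h) (@bmres_r M U V h).

HB.instance Definition _ (U V : opens X) (h : V `<=` U) :=
  GRing.RMorphism.copy (talg_res h)
    (talg_map (@bmres_l M U V h) (@bmres_r M U V h)).

Lemma talg_res_id (U : opens X) (h : U `<=` U) s : talg_res h s = s.
Proof.
apply: (@talg_ext _ _ _ (talg_res h) idfun) => w /=.
rewrite [LHS]talg_map_gen; congr tgen.
by elim: w => [b|m w IH] /=; rewrite ?rres_id ?bmres_id ?IH.
Qed.

Lemma talg_res_comp (U V W : opens X) (hVU : V `<=` U) (hWV : W `<=` V)
  (hWU : W `<=` U) s : talg_res hWV (talg_res hVU s) = talg_res hWU s.
Proof.
apply: (@talg_ext _ _ _ (talg_res hWV \o talg_res hVU) (talg_res hWU)) => w /=.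
rewrite [talg_res hVU _]talg_map_gen [LHS]talg_map_gen [RHS]talg_map_gen; congr tgen.
by elim: w => [b|m w IH] /=; rewrite ?(rres_comp _ _ hWU) ?(bmres_comp _ _ hWU) ?IH.
Qed.

Definition talg_psh : ringPresheaf X :=
  @RingPresheaf X (fun U => talg (M U)) (fun U V h => talg_res h)
    talg_res_id talg_res_comp.

Definition tensor_algebra : ringSheaf X := ring_sheafify talg_psh.

End TensorAlgebraSheaf.

Section QuotientSheaf.
Variables (X : topologicalType) (A : ringSheaf X).

Record idealSheaf := IdealSheaf {
  idl :> forall U : opens X, set (A U);
  idl_two_sided : forall U, two_sided (@idl U);
  idl_res : forall (U V : opens X) (h : V `<=` U) s, idl s -> idl (rres A h s);
  idl_local : forall (U : opens X) (s : A U),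
    (forall x, oset U x -> exists (V : opens X) (h : V `<=` U),
       oset V x /\ idl (rres A h s)) -> idl s }.

Variable K : idealSheaf.

Definition quot_res (U V : opens X) (h : V `<=` U) :
    qring (idl_two_sided K U) -> qring (idl_two_sided K V) :=
  qring_map (phi := rres A h) (@idl_res K U V h).

HB.instance Definition _ (U V : opens X) (h : V `<=` U) :=
  GRing.RMorphism.copy (quot_res h) (qring_map (phi := rres A h) (@idl_res K U V h)).

Lemma quot_resE (U V : opens X) (h : V `<=` U) a :
  quot_res h (qcl _ a) = qcl _ (rres A h a).
Proof. exact: qring_map_cl. Qed.

Lemma quot_res_id (U : opens X) (h : U `<=` U) s : quot_res h s = s.
Proof. by elim/qring_ind: s => a; rewrite quot_resE rres_id. Qed.

Lemma quot_res_comp (U V W : opens X) (hVU : V `<=` U) (hWV : W `<=` V)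
  (hWU : W `<=` U) s : quot_res hWV (quot_res hVU s) = quot_res hWU s.
Proof. by elim/qring_ind: s => a; rewrite !quot_resE (rres_comp _ _ hWU). Qed.

Definition quot_psh : ringPresheaf X :=
  @RingPresheaf X (fun U => qring (idl_two_sided K U)) (fun U V h => quot_res h)
    quot_res_id quot_res_comp.

Definition quot_sheaf : ringSheaf X := ring_sheafify quot_psh.

Definition quot_proj : ringHom A quot_sheaf.
Proof.
refine (@RingHom X A quot_sheaf
  (fun U => (@shr_unit X quot_psh U) \o (qcl (idl_two_sided K U))) _).
move=> U V h s /=; rewrite -quot_resE.
exact: (rhom_res (ring_unit quot_psh)).
Defined.

End QuotientSheaf.

Section RestrictScalars.
Variables (R S : pzRingType) (phi : {rmorphism R -> S}) (V : lmodType S).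

Definition rscal of {rmorphism R -> S} : Type := V.
HB.instance Definition _ := GRing.Zmodule.on (rscal phi).

Definition rscalZ (a : R) (v : rscal phi) : rscal phi := phi a *: (v : V).

Lemma rscalZA a b v : rscalZ a (rscalZ b v) = rscalZ (a * b) v.
Proof. by rewrite /rscalZ scalerA rmorphM. Qed.
Lemma rscal1Z : left_id 1 rscalZ.
Proof. by move=> v; rewrite /rscalZ rmorph1 scale1r. Qed.
Lemma rscalZDr : right_distributive rscalZ +%R.
Proof. by move=> a u v; exact: scalerDr. Qed.
Lemma rscalZDl v : {morph rscalZ^~ v : a b / a + b}.
Proof. by move=> a b; rewrite /rscalZ rmorphD; exact: scalerDl. Qed.

HB.instance Definition _ := GRing.Zmodule_isLmodule.Build R (rscal phi)
  rscalZA rscal1Z rscalZDr rscalZDl.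

End RestrictScalars.

Section RestrictScalarsSheaf.
Variables (X : topologicalType) (A A' : ringSheaf X) (phi : ringHom A A').

Lemma restr_resZ (N : modSheaf A') (U V : opens X) (h : V `<=` U) (a : A U)
  (s : rscal (N U) (phi U)) :
  mres N h (a *: s : rscal (N U) (phi U)) =
  rres A h a *: (mres N h s : rscal (N V) (phi V)).
Proof. by have := mresZ h (phi U a) (s : N U); rewrite rhom_res. Qed.

Definition restr_psh (N : modSheaf A') : modPresheaf A :=
  @ModPresheaf X A (fun U => rscal (N U) (phi U))
    (fun U V h => mres N h) (@restr_resZ N) (@mres_id X A' N) (@mres_comp X A' N).

Definition restr_mod (N : modSheaf A') : modSheaf A :=
  @ModSheaf X A (restr_psh N) (@mod_sheafP X A' N).

Definition restr_fun (M N : modSheaf A') (f : modHom M N) (U : opens X)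
  (s : restr_mod M U) : restr_mod N U := f U s.

Lemma restr_fun_linear (M N : modSheaf A') (f : modHom M N) U :
  linear (@restr_fun M N f U).
Proof. by move=> a s t; exact: (linearP (f U)). Qed.

HB.instance Definition _ (M N : modSheaf A') (f : modHom M N) U :=
  GRing.isLinear.Build (A U) (restr_mod M U) (restr_mod N U) _
    (@restr_fun M N f U) (@restr_fun_linear M N f U).

Definition restr_hom (M N : modSheaf A') (f : modHom M N) :
  modHom (restr_mod M) (restr_mod N) :=
  @ModHom X A (restr_mod M) (restr_mod N) (fun U => @restr_fun M N f U) (@mhom_res _ _ _ _ f).

Definition restriction : functor (modCat A') (modCat A).
Proof.
refine (@Functor (modCat A') (modCat A) restr_mod restr_hom _ _).
- by move=> M; apply: modHom_ext.
- by move=> L M N g f; apply: modHom_ext.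
Defined.

End RestrictScalarsSheaf.

Section FreeModule.
Variables (X : topologicalType) (A : ringSheaf X) (J : Type).

(* Sections of the free module on J, the direct sum of J copies of A in the category
   of sheaves: families of sections of A that are locally of finite support. *)
Definition lfin (U : opens X) : {pred J -> (A U)^o} := fun s : J -> (A U)^o =>
  `[< forall x, oset U x -> exists (V : opens X) (h : V `<=` U),
        oset V x /\ finite_set [set j | rres A h (s j) <> 0] >].
Arguments lfin : clear implicits.

Lemma lfin_submod U : submod_closed (lfin U).
Proof.
split=> [|a s t /asboolP hs /asboolP ht]; apply/asboolP => x Ux.
  exists U, (@subset_refl _ U); split=> //.
  by rewrite (_ : [set j | _] = set0) //; apply/seteqP; split=> // j /=; rewrite raddf0.
have [V [h [Vx fs]]] := hs x Ux; have [W [k [Wx ft]]] := ht x Ux.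
exists (openI V W), (subset_trans (@openIl _ V W) h); split=> //.
apply: sub_finite_set (_ : finite_set ([set j | rres A h (s j) <> 0] `|`
                                       [set j | rres A k (t j) <> 0])); last first.
  by rewrite finite_setU.
move=> j /= nz; apply: contrapT => /not_orP [/contrapT sj /contrapT tj]; apply: nz.
rewrite [_ j](_ : _ = a * s j + t j) // rmorphD rmorphM.
rewrite -(rres_comp h (@openIl _ V W) _ (s j)) sj raddf0 mulr0 add0r.
rewrite (Prop_irrelevance (subset_trans _ _) (subset_trans (@openIr _ V W) k)).
by rewrite -(rres_comp k (@openIr _ V W)) tj raddf0.
Qed.

HB.instance Definition _ U :=
  GRing.isSubmodClosed.Build (A U) (J -> (A U)^o) (lfin U) (lfin_submod U).

Record free_sec (U : opens X) := FreeSec {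
  free_val :> J -> (A U)^o;
  free_valP : free_val \in lfin U }.

HB.instance Definition _ U := [isSub for @free_val U].
HB.instance Definition _ U := gen_eqMixin (free_sec U).
HB.instance Definition _ U := [Choice of free_sec U by <:].
HB.instance Definition _ U := [SubChoice_isSubLmodule of free_sec U by <:].

Lemma free_ext U (s t : free_sec U) : (forall j, s j = t j) -> s = t.
Proof. by move=> e; apply/val_inj/funext. Qed.

Lemma free_res_subproof (U V : opens X) (h : V `<=` U) (s : free_sec U) :
  (fun j => rres A h (s j) : (A V)^o) \in lfin V.
Proof.
case: s => s /= /asboolP fs; apply/asboolP => x Vx.
have [W [k [Wx fW]]] := fs x (h _ Vx).
exists (openI W V), (@openIr _ W V); split=> //.
apply: sub_finite_set fW => j /= nz; apply: contra_not nz => sj.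
rewrite (rres_comp _ _ (subset_trans (@openIr _ W V) h)).
rewrite (Prop_irrelevance (subset_trans _ _) (subset_trans (@openIl _ W V) k)).
by rewrite -(rres_comp k (@openIl _ W V)) sj raddf0.
Qed.

Definition free_res (U V : opens X) (h : V `<=` U) (s : free_sec U) : free_sec V :=
  FreeSec (free_res_subproof h s).

Lemma free_res_additive (U V : opens X) (h : V `<=` U) : zmod_morphism (free_res h).
Proof. by move=> s t; apply: free_ext => j; exact: (rmorphB (rres A h)). Qed.
HB.instance Definition _ (U V : opens X) (h : V `<=` U) :=
  GRing.isZmodMorphism.Build (free_sec U) (free_sec V) (free_res h)
    (@free_res_additive U V h).

Definition free_psh : modPresheaf A.
Proof.
refine (@ModPresheaf X A (fun U => free_sec U) (fun U V h => free_res h) _ _ _).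
- by move=> U V h a s; apply: free_ext => j; exact: (rmorphM (rres A h)).
- by move=> U h s; apply: free_ext => j; exact: rres_id.
- by move=> U V W hVU hWV hWU s; apply: free_ext => j; exact: rres_comp.
Defined.

Lemma free_sheafP : is_sheaf (psh_of_z (z_of_mod free_psh)).
Proof.
move=> U C V hV cov; split=> [s t e|s e].
  apply: free_ext => j.
  apply: (proj1 (@ring_sheafP X A U C V hV cov) (s j : A U) (t j : A U)) => i.
  exact: (congr1 (fun u : free_sec _ => u j) (e i)).
have glue j : exists t : A U, forall i, rres A (hV i) t = s i j.
  apply: (proj2 (@ring_sheafP X A U C V hV cov) (fun i => s i j : A (V i))) => i k.
  exact: (congr1 (fun u : free_sec _ => u j) (e i k)).
pose t j : (A U)^o := projT1 (cid (glue j)).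
have tE j i : rres A (hV i) (t j) = s i j by rewrite /t; case: cid.
have tl : t \in lfin U.
  apply/asboolP => x /cov [i _ Vx].
  have /asboolP /(_ x Vx) [W [h [Wx fW]]] := free_valP (s i).
  exists W, (subset_trans h (hV i)); split=> //.
  by apply: sub_finite_set fW => j /=; rewrite -tE (rres_comp _ _ (subset_trans h (hV i))).
by exists (FreeSec tl) => i; apply: free_ext => j; exact: tE.
Qed.

Definition free_mod : modSheaf A := ModSheaf free_sheafP.

End FreeModule.

(* Every point has an open neighbourhood over which M is a direct summand of a
   free module (of arbitrary rank). *)
Definition locally_projective (X : topologicalType) (A : ringSheaf X) (M : modSheaf A) :
    Prop :=
  forall x : X, exists (U : opens X) (J : Type)
    (i : modHomOn U M (free_mod A J)) (p : modHomOn U (free_mod A J) M),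
    oset U x /\ forall (V : opens X) (h : V `<=` U) (s : M V), mhon p h (mhon i h s) = s.

Record quiver := Quiver {
  vertex : finType;
  arrow : finType;
  tail : arrow -> vertex;
  head : arrow -> vertex }.

Section TwistedQuiver.
Variables (X : topologicalType) (O : comRingSheaf X) (Q : quiver).

(* The sheaf of algebras with sections sum_i O(U) e_i, i.e. O(U)-valued functions
   on the vertices with pointwise operations; e_i is the indicator of i. *)
Definition base_res (U V : opens X) (h : V `<=` U) (b : vertex Q -> O U) :
  vertex Q -> O V := fun i => rres O h (b i).

Lemma base_res_additive (U V : opens X) (h : V `<=` U) : zmod_morphism (base_res h).
Proof. by move=> b c; apply/funext => i; exact: rmorphB. Qed.
Lemma base_res_monoid (U V : opens X) (h : V `<=` U) : monoid_morphism (base_res h).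
Proof.
by split=> [|b c]; apply/funext => i; [exact: rmorph1|exact: rmorphM].
Qed.
HB.instance Definition _ (U V : opens X) (h : V `<=` U) :=
  GRing.isZmodMorphism.Build (vertex Q -> O U) (vertex Q -> O V) (base_res h)
    (@base_res_additive U V h).
HB.instance Definition _ (U V : opens X) (h : V `<=` U) :=
  GRing.isMonoidMorphism.Build (vertex Q -> O U) (vertex Q -> O V) (base_res h)
    (@base_res_monoid U V h).

Definition base_psh : ringPresheaf X.
Proof.
refine (@RingPresheaf X (fun U => vertex Q -> O U) (fun U V h => base_res h) _ _).
- by move=> U h b; apply/funext => i; exact: rres_id.
- by move=> U V W hVU hWV hWU b; apply/funext => i; exact: rres_comp.
Defined.

Variable M : arrow Q -> modSheaf O.

(* The finite direct sum of the M_a, with e_i x = x if i is the head of a and 0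
   otherwise, and x e_i = x if i is the tail of a and 0 otherwise, for x in M_a. *)
Definition arrow_sec (U : opens X) : Type := forall a : arrow Q, M a U.

Section ArrowSec.
Variable U : opens X.
HB.instance Definition _ := Choice.on (arrow_sec U).

Implicit Types m n : arrow_sec U.
Lemma arrow_ext m n : (forall a, m a = n a) -> m = n.
Proof. exact: functional_extensionality_dep. Qed.

Definition arrow0 : arrow_sec U := fun a => 0.
Definition arrowN m : arrow_sec U := fun a => - m a.
Definition arrowD m n : arrow_sec U := fun a => m a + n a.
Lemma arrowDA : associative arrowD.
Proof. by move=> m n p; apply: arrow_ext => a; exact: addrA. Qed.
Lemma arrowDC : commutative arrowD.
Proof. by move=> m n; apply: arrow_ext => a; exact: addrC. Qed.
Lemma arrow0D : left_id arrow0 arrowD.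
Proof. by move=> m; apply: arrow_ext => a; exact: add0r. Qed.
Lemma arrowNm : left_inverse arrow0 arrowN arrowD.
Proof. by move=> m; apply: arrow_ext => a; exact: addNr. Qed.
HB.instance Definition _ := GRing.isZmodule.Build (arrow_sec U)
  arrowDA arrowDC arrow0D arrowNm.

Definition arrow_bimod : bimod (base_psh U).
Proof.
refine (@Bimod (base_psh U) (arrow_sec U)
  (fun (b : vertex Q -> O U) m a => b (head a) *: m a)
  (fun m (b : vertex Q -> O U) a => b (tail a) *: m a) _ _ _ _ _ _ _ _ _).
- by move=> b c m; apply: arrow_ext => a; exact: scalerDl.
- by move=> b m n; apply: arrow_ext => a; exact: scalerDr.
- by move=> m; apply: arrow_ext => a; exact: scale1r.
- by move=> b c m; apply: arrow_ext => a; exact: scalerA.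
- by move=> m n b; apply: arrow_ext => a; exact: scalerDr.
- by move=> m b c; apply: arrow_ext => a; exact: scalerDl.
- by move=> m; apply: arrow_ext => a; exact: scale1r.
- by move=> m b c; apply: arrow_ext => a; rewrite scalerA com_mulC.
- by move=> b m c; apply: arrow_ext => a; rewrite !scalerA com_mulC.
Defined.
End ArrowSec.

Definition arrow_res (U V : opens X) (h : V `<=` U) (m : arrow_sec U) : arrow_sec V :=
  fun a => mres (M a) h (m a).
Lemma arrow_res_additive (U V : opens X) (h : V `<=` U) : zmod_morphism (arrow_res h).
Proof. by move=> m n; apply: arrow_ext => a; exact: raddfB. Qed.
HB.instance Definition _ (U V : opens X) (h : V `<=` U) :=
  GRing.isZmodMorphism.Build (arrow_sec U) (arrow_sec V) (arrow_res h)
    (@arrow_res_additive U V h).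

Definition arrow_bimod_psh : bimodPresheaf base_psh.
Proof.
refine (@BimodPresheaf X base_psh arrow_bimod (fun U V h => arrow_res h) _ _ _ _).
- by move=> U V h b m; apply: arrow_ext => a; exact: mresZ.
- by move=> U V h m b; apply: arrow_ext => a; exact: mresZ.
- by move=> U h m; apply: arrow_ext => a; exact: mres_id.
- by move=> U V W hVU hWV hWU m; apply: arrow_ext => a; exact: mres_comp.
Defined.

Definition twisted_algebra : ringSheaf X := tensor_algebra arrow_bimod_psh.

Record twisted_rep := TwistedRep {
  rep_mod : vertex Q -> modSheaf O;
  rep_map : forall a : arrow Q,
    modHom (tensor (M a) (rep_mod (tail a))) (rep_mod (head a)) }.

Record rep_hom (V W : twisted_rep) := RepHom {
  rep_fun : forall i : vertex Q, modHom (rep_mod V i) (rep_mod W i);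
  rep_funP : forall a : arrow Q,
    modHom_comp (rep_fun (head a)) (rep_map V a) =
    modHom_comp (rep_map W a) (tensor_map (modHom_id (M a)) (rep_fun (tail a))) }.

Lemma rep_hom_ext (V W : twisted_rep) (f g : rep_hom V W) :
  (forall i, rep_fun f i = rep_fun g i) -> f = g.
Proof.
case: f => f fP; case: g => g gP /= e.
have {}e : f = g by exact: functional_extensionality_dep.
by subst g; rewrite (Prop_irrelevance fP gP).
Qed.

Lemma modHom_compA (A : ringPresheaf X) (K L N P : modPresheaf A)
  (h : modHom N P) (g : modHom L N) (f : modHom K L) :
  modHom_comp h (modHom_comp g f) = modHom_comp (modHom_comp h g) f.
Proof. exact: modHom_ext. Qed.

Lemma modHom_comp1f (A : ringPresheaf X) (L N : modPresheaf A) (f : modHom L N) :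
  modHom_comp (modHom_id N) f = f.
Proof. exact: modHom_ext. Qed.

Lemma modHom_compf1 (A : ringPresheaf X) (L N : modPresheaf A) (f : modHom L N) :
  modHom_comp f (modHom_id L) = f.
Proof. exact: modHom_ext. Qed.

Definition rep_hom_id (V : twisted_rep) : rep_hom V V.
Proof.
refine (@RepHom V V (fun i => modHom_id (rep_mod V i)) _).
by move=> a; rewrite tensor_map_id modHom_comp1f modHom_compf1.
Defined.

Definition rep_hom_comp (U V W : twisted_rep) (g : rep_hom V W) (f : rep_hom U V) :
  rep_hom U W.
Proof.
refine (@RepHom U W (fun i => modHom_comp (rep_fun g i) (rep_fun f i)) _).
move=> a; rewrite -modHom_compA rep_funP modHom_compA rep_funP -modHom_compA.
by rewrite -tensor_map_comp modHom_compf1.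
Defined.

Definition repCat : category.
Proof.
refine (@Category twisted_rep rep_hom rep_hom_id rep_hom_comp _ _ _).
- by move=> V W f; apply: rep_hom_ext => i; exact: modHom_comp1f.
- by move=> V W f; apply: rep_hom_ext => i; exact: modHom_compf1.
- by move=> U V W Z h g f; apply: rep_hom_ext => i; exact: modHom_compA.
Defined.

End TwistedQuiver.

(* Main.v *)
(* A left module N over the twisted algebra A splits as the direct sum of the O-modules
   e_i N, because the e_i are orthogonal idempotents with sum 1; left multiplication by
   M_a maps e_(tail a) N into e_(head a) N, which is a representation.  Conversely a
   representation V gives an action of words of the presheaf tensor algebra on the
   direct sum of the V_i, and this action extends uniquely to sections of the
   sheafification A, by gluing local values.  Since A is locally generated by the base
   algebra and the M_a, a morphism of representations is automatically A-linear, so the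
   functor is fully faithful.  Restriction along a locally surjective morphism of sheaves
   of rings, such as A -> A/K, is fully faithful as well. *)
From Pilot Require Import Defs.
From HB Require Import structures.
From mathcomp Require Import all_boot all_algebra.
From mathcomp Require Import all_classical topology.
Import Pilot.Defs.

Set Implicit Arguments.
Unset Strict Implicit.
Unset Printing Implicit Defensive.

Import GRing.Theory.
Local Open Scope classical_set_scope.
Local Open Scope ring_scope.

(** * Fully faithful functors and equivalences of categories *)

Lemma inj_surj_bij (A B : Type) (f : A -> B) :
  injective f -> (forall b, exists a, f a = b) -> bijective f.
Proof.
move=> fI fS; pose g b := projT1 (cid (fS b)).
have gK b : f (g b) = b by rewrite /g; case: cid.
by exists g => // a; apply: fI.
Qed.

Lemma fully_faithful_comp (C D E : category) (G : functor D E) (F : functor C D) :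
  fully_faithful G -> fully_faithful F -> fully_faithful (comp_functor G F).
Proof. by move=> Gf Ff a b; exact: (bij_comp (Gf _ _) (Ff a b)). Qed.

(** A quasi-inverse is chosen object by object, together with isomorphisms [ep d]; a morphism is
    conjugated by these and lifted through [F]. Faithfulness lets the functor laws be checked after
    applying [F]. *)
Lemma ff_esurj_equivalence (C D : category) (F : functor C D) :
  fully_faithful F ->
  (forall d : obj D, exists (c : obj C) (f : hom (fobj F c) d), is_iso f) ->
  is_equivalence F.
Proof.
move=> Ff Fs.
(* [bijective] is a proposition, so the inverse is extracted by choice from an existential statement
   whose second conjunct is trivial. *)
pose inv a b (u : hom (fobj F a) (fobj F b)) : hom a b :=
  s2val (cid2 (let: Bijective g fK gK := Ff a b in
    ex_intro2 (fun f => fmap F f = u) (fun=> True) (g u) (gK u) I)).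
have invK a b (u : hom (fobj F a) (fobj F b)) : fmap F (inv a b u) = u.
  by rewrite /inv; case: cid2.
have F_inj a b (f g : hom a b) : fmap F f = fmap F g -> f = g.
  by move=> e; exact: (bij_inj (Ff a b)) e.
pose G0 d := projT1 (cid (Fs d)).
pose ep d : hom (fobj F (G0 d)) d := projT1 (cid (projT2 (cid (Fs d)))).
have ep_iso d : is_iso (ep d) := projT2 (cid (projT2 (cid (Fs d)))).
pose ei d : hom d (fobj F (G0 d)) := projT1 (cid (ep_iso d)).
have eiK d : cmp (ei d) (ep d) = idm _ by rewrite /ei; case: cid => ? [].
have epK d : cmp (ep d) (ei d) = idm _ by rewrite /ei; case: cid => ? [].
pose G1 d d' (u : hom d d') : hom (G0 d) (G0 d') :=
  inv _ _ (cmp (ei d') (cmp u (ep d))).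
have FG1 d d' (u : hom d d') : fmap F (G1 d d' u) = cmp (ei d') (cmp u (ep d)).
  exact: invK.
have G_id d : G1 d d (idm d) = idm (G0 d).
  by apply: F_inj; rewrite FG1 cmp_idl eiK fmap_id.
have G_cmp a b c (g : hom b c) (f : hom a b) :
    G1 a c (cmp g f) = cmp (G1 b c g) (G1 a b f).
  apply: F_inj; rewrite fmap_cmp !FG1 -!cmp_assoc; congr (cmp _ (cmp g _)).
  by rewrite !cmp_assoc epK cmp_idl.
exists (Functor G_id G_cmp); split.
(* The isomorphism from [G (F a)] to [a] is the lift of [ep (F a)] through [F]. *)
- exists (fun a => inv _ _ (ep (fobj F a))); split=> [a|a b f].
    exists (inv _ _ (ei (fobj F a))).
    by split; refine (F_inj _ _ _ _ _); rewrite fmap_cmp !invK ?eiK ?epK fmap_id.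
  refine (F_inj _ _ _ _ _); rewrite /= !fmap_cmp FG1 !invK.
  by rewrite cmp_assoc epK cmp_idl.
- exists ep; split=> [//|a b f].
  by rewrite /= FG1 cmp_assoc epK cmp_idl.
Qed.

(** * Extension from a presheaf to its sheafification *)

Section SheafExtension.
Variables (X : topologicalType) (F G : presheaf X).
Hypothesis Gsh : is_sheaf G.

Lemma sheaf_eq_local (U : opens X) (s t : G U) :
  (forall x, oset U x ->
    exists (W : opens X) (h : W `<=` U), oset W x /\ pres h s = pres h t) ->
  s = t.
Proof.
move=> loc.
(* Indexing by every open subset on which [s] and [t] agree gives a cover of [U] without choosing
   neighbourhoods. *)
pose C := {W : opens X | exists h : W `<=` U, pres h s = pres h t}.
have hV (c : C) : projT1 c `<=` U by case: (projT2 c).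
have cov : U `<=` \bigcup_(c : C) projT1 c.
  by move=> x /loc [W [h [Wx e]]]; exists (exist _ W (ex_intro _ h e)).
apply: (Gsh hV cov).1 => c.
by have [h e] := projT2 c; rewrite (Prop_irrelevance (hV c) h).
Qed.

Lemma sh_res_unit (U V : opens X) (h : V `<=` U) (t : F U) :
  sh_res h (sh_unit t) = sh_unit (pres h t).
Proof. by apply: shsec_ext => x Vx; rewrite sh_resE// (sh_unitE t h). Qed.

Lemma sh_unit_local (U : opens X) (s : shsec F U) x : oset U x ->
  exists (W : opens X) (h : W `<=` U) (t : F W), oset W x /\ sh_res h s = sh_unit t.
Proof.
move=> /(shval_loc s) [W [t [Wx WU e]]]; exists W, WU, t; split=> //.
by apply: shsec_ext => y Wy; rewrite sh_resE// e.
Qed.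

(** The unit need not be injective; sections with equal images have equal germs, hence agree near
    each point. *)
Lemma sh_unit_eq (U : opens X) (s t : F U) x : oset U x ->
  sh_unit s = sh_unit t ->
  exists (W : opens X) (h : W `<=` U), oset W x /\ pres h s = pres h t.
Proof.
move=> Ux /(congr1 (fun u => shval u x)) /(germ_eqP Ux) [W [h [h' [Wx e]]]].
by exists W, h; split=> //; rewrite e (Prop_irrelevance h h').
Qed.

(** The values of [f] on all local representatives of [s] form a compatible family, which glues
    since [G] is a sheaf. As [f] is any natural family and may depend on the inclusion of [W] in
    [U], this serves both for module morphisms and for actions on a fixed section. *)
Lemma sh_extend (U : opens X) (f : forall W : opens X, W `<=` U -> F W -> G W)
    (nf : forall (W N : opens X) (hW : W `<=` U) (hN : N `<=` U) (h : N `<=` W) t,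
      pres h (f W hW t) = f N hN (pres h t)) (s : shsec F U) :
  exists n : G U, forall (W : opens X) (h : W `<=` U) (t : F W),
    sh_res h s = sh_unit t -> pres h n = f W h t.
Proof.
(* The cover consists of all pairs of an open subset and a presheaf section representing [s]
   there. *)
pose C := {W : opens X & {t : F W | exists h : W `<=` U, sh_res h s = sh_unit t}}.
have hV (c : C) : projT1 c `<=` U by case: (projT2 c) => t [].
pose n (c : C) := f _ (hV c) (sval (projT2 c)).
have cov : U `<=` \bigcup_(c : C) projT1 c.
  move=> x /(sh_unit_local s) [W [h [t [Wx e]]]].
  by exists (existT _ W (exist _ t (ex_intro _ h e))).
have sV (c : C) : sh_res (hV c) s = sh_unit (sval (projT2 c)).
  have [h e] := svalP (projT2 c).
  by rewrite (Prop_irrelevance (hV c) h).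
have [c d|m mE] := (Gsh hV cov).2 n.
  rewrite /n (nf _ _ _ (subset_trans (@openIl _ _ _) (hV c))).
  rewrite (nf _ _ _ (subset_trans (@openIl _ _ _) (hV c))).
  (* On an overlap two representatives of [s] have the same image under the unit, which makes them
     agree only locally; equality of their values is therefore checked locally too. *)
  apply: sheaf_eq_local => x Ix.
  have := sh_res_unit (@openIl _ (projT1 c) (projT1 d)) (sval (projT2 c)).
  rewrite -sV [LHS](@pres_comp _ (shpsh F) _ _ _ _ _
    (subset_trans (@openIl _ _ _) (hV c))) => e1.
  have := sh_res_unit (@openIr _ (projT1 c) (projT1 d)) (sval (projT2 d)).
  rewrite -sV [LHS](@pres_comp _ (shpsh F) _ _ _ _ _
    (subset_trans (@openIl _ _ _) (hV c))) => e2.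
  have [W [h [Wx e]]] := sh_unit_eq Ix (etrans (esym e1) e2).
  exists W, h; split=> //.
  rewrite (nf _ _ _ (subset_trans h (subset_trans (@openIl _ _ _) (hV c)))).
  by rewrite (nf _ _ _ (subset_trans h (subset_trans (@openIl _ _ _) (hV c)))) e.
exists m => W h t e.
pose c : C := existT _ W (exist _ t (ex_intro _ h e)).
by have := mE c; rewrite /n (Prop_irrelevance (hV c) h).
Qed.

End SheafExtension.

Section SheafifyLift.
Variables (X : topologicalType) (A : ringSheaf X).

Definition mod_unit_fun (P : modPresheaf A) U (t : P U) : mod_sheafify P U :=
  shz_unit (F := z_of_mod P) t.

Lemma mod_unit_linear (P : modPresheaf A) U : linear (@mod_unit_fun P U).
Proof.
move=> a s t; rewrite [LHS](raddfD (@shz_unit X (z_of_mod P) U)); congr (_ + _).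
apply: shsec_ext => x Ux.
have e : shval (shz_unit (F := z_of_mod P) s) x =
  germ (F := psh_of_z (z_of_mod P)) s x by [].
by rewrite (shmZE a (@subset_refl _ _) Ux e) rres_id.
Qed.

HB.instance Definition _ (P : modPresheaf A) U := GRing.isLinear.Build (A U) (P U)
  (mod_sheafify P U) _ (@mod_unit_fun P U)
  (@mod_unit_linear P U).

Definition mod_unit (P : modPresheaf A) : modHom P (mod_sheafify P) :=
  @ModHom X A P (mod_sheafify P) (fun U => @mod_unit_fun P U)
    (@shz_unit_res X (z_of_mod P)).

Lemma mod_eq_local (N : modSheaf A) (U : opens X) (s t : N U) :
  (forall x, oset U x ->
    exists (W : opens X) (h : W `<=` U), oset W x /\ mres N h s = mres N h t) ->
  s = t.
Proof. exact: (sheaf_eq_local (@mod_sheafP _ _ N)). Qed.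

Lemma mod_unit_local (P : modPresheaf A) (U : opens X) (s : mod_sheafify P U) x :
  oset U x -> exists (W : opens X) (h : W `<=` U) (t : P W),
    oset W x /\ mres (mod_sheafify P) h s = mod_unit P W t.
Proof. exact: (@sh_unit_local X (psh_of_z (z_of_mod P)) U s x). Qed.

(** Every section of the sheafification is locally in the image of the unit, and equality in [N] is
    local. *)
Lemma mod_sheafify_ext (P : modPresheaf A) (N : modSheaf A)
    (f g : modHom (mod_sheafify P) N) :
  (forall U t, f U (mod_unit P U t) = g U (mod_unit P U t)) -> f = g.
Proof.
move=> fg; apply: modHom_ext => U s; apply: mod_eq_local => x Ux.
have [W [h [t [Wx e]]]] := mod_unit_local s Ux.
by exists W, h; split=> //; rewrite !mhom_res e fg.
Qed.

Section Lift.
Variables (P : modPresheaf A) (N : modSheaf A) (f : modHom P N).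

Lemma sheafify_lift_ex (U : opens X) (s : mod_sheafify P U) :
  exists n : N U, forall (W : opens X) (h : W `<=` U) (t : P W),
    mres (mod_sheafify P) h s = mod_unit P W t -> mres N h n = f W t.
Proof.
have nf (W V : opens X) (hW : W `<=` U) (hV : V `<=` U) (h : V `<=` W) t :
  mres N h (f W t) = f V (mres P h t) by exact: mhom_res.
exact: (@sh_extend X (psh_of_z (z_of_mod P)) (psh_of_z (z_of_mod N))
  (@mod_sheafP _ _ N) U (fun W _ t => f W t) nf s).
Qed.

(** The choice is harmless: the local values determine the section, because sections of the
    sheafification are locally in the image of the unit and [N] is a sheaf. *)
Definition sheafify_lift_fun U (s : mod_sheafify P U) : N U :=
  projT1 (cid (sheafify_lift_ex s)).

Lemma sheafify_lift_local (U W : opens X) (h : W `<=` U) (s : mod_sheafify P U) t :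
  mres (mod_sheafify P) h s = mod_unit P W t ->
  mres N h (sheafify_lift_fun s) = f W t.
Proof. by rewrite /sheafify_lift_fun; case: cid => n /= /[apply]. Qed.

Lemma sheafify_lift_linear U : linear (@sheafify_lift_fun U).
Proof.
move=> a s s'; apply: mod_eq_local => x Ux.
have [W [h [t [Wx e]]]] := mod_unit_local s Ux.
have [W' [h' [t' [Wx' e']]]] := mod_unit_local s' Ux.
(* Both arguments are represented over a common neighbourhood, where [f] is linear. *)
pose k := subset_trans (@openIl _ W W') h.
pose c := mres P (@openIl _ W W') t; pose c' := mres P (@openIr _ W W') t'.
have ec : mres (mod_sheafify P) k s = mod_unit P _ c.
  by rewrite -(mres_comp h (@openIl _ W W')) e mhom_res.
have ec' : mres (mod_sheafify P) k s' = mod_unit P _ c'.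
  by rewrite -(mres_comp h' (@openIr _ W W')) e' mhom_res.
exists (openI W W'), k; split=> //.
rewrite raddfD mresZ (sheafify_lift_local ec) (sheafify_lift_local ec').
rewrite -linearP; apply: sheafify_lift_local.
by rewrite raddfD mresZ ec ec' linearP.
Qed.

HB.instance Definition _ U := GRing.isLinear.Build (A U) (mod_sheafify P U) (N U) _
  (@sheafify_lift_fun U) (@sheafify_lift_linear U).

Lemma sheafify_lift_res (U V : opens X) (h : V `<=` U) s :
  mres N h (sheafify_lift_fun s) = sheafify_lift_fun (mres (mod_sheafify P) h s).
Proof.
apply: mod_eq_local => x Vx.
have [W [k [t [Wx e]]]] := mod_unit_local (mres (mod_sheafify P) h s) Vx.
exists W, k; split=> //; rewrite (sheafify_lift_local e).
rewrite (mres_comp _ _ (subset_trans k h)); apply: sheafify_lift_local.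
by rewrite -e (mres_comp _ _ (subset_trans k h)).
Qed.

Definition sheafify_lift : modHom (mod_sheafify P) N :=
  ModHom sheafify_lift_res.

Lemma sheafify_lift_unit U t : sheafify_lift U (mod_unit P U t) = f U t.
Proof.
have := @sheafify_lift_local U U (@subset_refl _ U) (mod_unit P U t) t.
by rewrite !mres_id; apply.
Qed.

End Lift.
End SheafifyLift.

(** * Pure tensors and bilinear maps out of a tensor product sheaf *)

Section TensorLift.
Variables (X : topologicalType) (O : comRingSheaf X).

Definition tensor_pure (M V : modSheaf O) (U : opens X) (m : M U) (v : V U) :
  tensor M V U := mod_unit (tens_psh M V) U (pure (@com_mulC X O U) m v).

Lemma tensor_map_pure (M M' V V' : modSheaf O) (f : modHom M M') (g : modHom V V') U m v :
  tensor_map f g U (tensor_pure m v) = tensor_pure (f U m) (g U v).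
Proof.
apply: shsec_ext => x Ux.
have e : shval (tensor_pure m v) x =
   germ (F := psh_of_z (z_of_mod (tens_psh M V))) (pure (@com_mulC X O U) m v) x by [].
rewrite (sh1E (modHom_nat (tens_psh_map f g)) Ux Ux e).
by congr germ; apply: tens_psh_fun_pure.
Qed.

(** Pure tensors generate the presheaf tensor product additively, and the presheaf determines
    morphisms out of its sheafification. *)
Lemma tensor_ext (M V N : modSheaf O) (f g : modHom (tensor M V) N) :
  (forall U m v, f U (@tensor_pure M V U m v) = g U (tensor_pure m v)) -> f = g.
Proof.
move=> fg; apply: mod_sheafify_ext => U.
by apply: (@tens_ext _ _ _ _ _ (f U \o mod_unit (tens_psh M V) U)
  (g U \o mod_unit (tens_psh M V) U)) => m v; exact: fg.
Qed.

Section Lift.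
Variables (M V N : modSheaf O) (beta : forall U, M U -> V U -> N U).
Hypothesis betaDl : forall U m m' v, @beta U (m + m') v = beta m v + beta m' v.
Hypothesis betaDr : forall U m v v', @beta U m (v + v') = beta m v + beta m v'.
Hypothesis betaZl : forall U a m v, @beta U (a *: m) v = a *: beta m v.
Hypothesis betaZr : forall U a m v, @beta U m (a *: v) = a *: beta m v.
Hypothesis beta_res : forall (U W : opens X) (h : W `<=` U) m v,
  mres N h (beta m v) = beta (mres M h m) (mres V h v).

Lemma tens_lift_rel U s t : @tens_rel (O U) (M U) (V U) s t ->
  feval (fun p : M U * V U => beta p.1 p.2) s =
  feval (fun p : M U * V U => beta p.1 p.2) t.
Proof.
by case=> [m m' v|m v v'|a m v] /=; rewrite ?betaDl ?betaDr// betaZl betaZr.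
Qed.

Definition tens_lift U : tens_psh M V U -> N U := pext (@tens_lift_rel U).

HB.instance Definition _ U := GRing.isZmodMorphism.Build (tens_psh M V U) (N U)
  (@tens_lift U) (pext_additive (@tens_lift_rel U)).

Lemma tens_lift_pure U m v : @tens_lift U (pure _ m v) = beta m v.
Proof. exact: pext_gen. Qed.

Lemma tens_lift_scalable U : scalable (@tens_lift U).
Proof.
move=> a s; apply: (@tens_ext _ _ _ _ _ (@tens_lift U \o tensZ a)
  (GRing.scale a \o @tens_lift U)) => m v /=.
by rewrite tensZ_pure !tens_lift_pure betaZl.
Qed.

HB.instance Definition _ U := GRing.isScalable.Build (O U) (tens_psh M V U)
  (N U) _ (@tens_lift U) (@tens_lift_scalable U).

Lemma tens_lift_res (U W : opens X) (h : W `<=` U) s :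
  mres N h (tens_lift s) = tens_lift (mres (tens_psh M V) h s).
Proof.
apply: (@tens_ext _ _ _ _ _ (mres N h \o @tens_lift U)
  (@tens_lift W \o mres (tens_psh M V) h)) => m v /=.
by rewrite tens_res_pure !tens_lift_pure beta_res.
Qed.

(** The universal property of the tensor product, in two stages: the bilinear map extends to the
    presheaf tensor product, and the resulting presheaf morphism to the sheafification. *)
Definition tensor_lift : modHom (tensor M V) N :=
  sheafify_lift (@ModHom X O (tens_psh M V) N (fun U => @tens_lift U) tens_lift_res).

Lemma tensor_lift_pure U m v : tensor_lift U (tensor_pure m v) = beta m v.
Proof. by rewrite /tensor_lift sheafify_lift_unit; exact: tens_lift_pure. Qed.

End Lift.
End TensorLift.

(** * The subsheaf fixed by an endomorphism *)

Section FixedSubmodule.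
Variables (X : topologicalType) (A : ringSheaf X) (L : modSheaf A) (p : modHom L L).

(** For an idempotent [p] this is its image. An equation can be checked on a cover, so fixed
    sections glue within [L]. *)
Definition fixed_pred U : {pred L U} := fun s => `[< p U s = s >].
Arguments fixed_pred : clear implicits.

Lemma fixed_submod U : submod_closed (fixed_pred U).
Proof.
split=> [|a s t /asboolP hs /asboolP ht]; apply/asboolP; first exact: raddf0.
by rewrite linearP hs ht.
Qed.

HB.instance Definition _ U :=
  GRing.isSubmodClosed.Build (A U) (L U) (fixed_pred U) (fixed_submod U).

Record fixed_sec (U : opens X) := FixedSec {
  fixed_val : L U;
  fixed_valP : fixed_val \in fixed_pred U }.

HB.instance Definition _ U := [isSub for @fixed_val U].
HB.instance Definition _ U := gen_eqMixin (fixed_sec U).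
HB.instance Definition _ U := [Choice of fixed_sec U by <:].
HB.instance Definition _ U := [SubChoice_isSubLmodule of fixed_sec U by <:].

Lemma fixedE U (s : fixed_sec U) : p U (fixed_val s) = fixed_val s.
Proof. exact/asboolP/fixed_valP. Qed.

Lemma fixed_res_subproof (U V : opens X) (h : V `<=` U) (s : fixed_sec U) :
  mres L h (fixed_val s) \in fixed_pred V.
Proof. by apply/asboolP; rewrite -mhom_res fixedE. Qed.

Definition fixed_res (U V : opens X) (h : V `<=` U) (s : fixed_sec U) : fixed_sec V :=
  FixedSec (fixed_res_subproof h s).

Lemma fixed_res_additive (U V : opens X) (h : V `<=` U) : zmod_morphism (fixed_res h).
Proof. by move=> s t; apply: val_inj; exact: (raddfB (mres L h)). Qed.
HB.instance Definition _ (U V : opens X) (h : V `<=` U) :=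
  GRing.isZmodMorphism.Build (fixed_sec U) (fixed_sec V) (fixed_res h)
    (@fixed_res_additive U V h).

Definition fixed_psh : modPresheaf A.
Proof.
refine (@ModPresheaf X A (fun U => fixed_sec U) (fun U V h => fixed_res h) _ _ _).
- by move=> U V h a s; apply: val_inj; exact: mresZ.
- by move=> U h s; apply: val_inj; exact: mres_id.
- by move=> U V W hVU hWV hWU s; apply: val_inj; exact: mres_comp.
Defined.

Lemma fixed_sheafP : is_sheaf (psh_of_z (z_of_mod fixed_psh)).
Proof.
move=> U C V hV cov; split=> [s t e|s e].
  apply: val_inj.
  apply: (proj1 (@mod_sheafP X A L U C V hV cov) (fixed_val s) (fixed_val t)) => i.
  exact: (congr1 (fun u : fixed_sec _ => fixed_val u) (e i)).
have [t tE] : exists t : L U, forall i, mres L (hV i) t = fixed_val (s i).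
  apply: (proj2 (@mod_sheafP X A L U C V hV cov) (fun i => fixed_val (s i))) => i k.
  exact: (congr1 (fun u : fixed_sec _ => fixed_val u) (e i k)).
have tl : t \in fixed_pred U.
  apply/asboolP; apply: (proj1 (@mod_sheafP X A L U C V hV cov)) => i /=.
  by rewrite mhom_res tE fixedE.
by exists (FixedSec tl) => i; apply: val_inj; exact: tE.
Qed.

Definition fixed_mod : modSheaf A := ModSheaf fixed_sheafP.

End FixedSubmodule.

(** * Module structures from ring actions, extended to sheafified rings *)

Record ring_action (R : pzRingType) (Z : zmodType) := RingAction {
  act : R -> Z -> Z;
  actA : forall a b z, act a (act b z) = act (a * b) z;
  act1 : forall z, act 1 z = z;
  actDr : forall a y z, act a (y + z) = act a y + act a z;
  actDl : forall a b z, act (a + b) z = act a z + act b z }.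

Section ActionModule.
Variables (R : pzRingType) (Z : zmodType) (r : ring_action R Z).

(** A copy of [Z] tagged with [r], to which the module structure given by [r] can be attached
    without affecting [Z]. *)
Definition act_mod of ring_action R Z : Type := Z.
HB.instance Definition _ := GRing.Zmodule.on (act_mod r).

Definition act_modZ (a : R) (z : act_mod r) : act_mod r := act r a z.
Lemma act_modZA a b z : act_modZ a (act_modZ b z) = act_modZ (a * b) z.
Proof. exact: (actA r a b z). Qed.
Lemma act_mod1Z : left_id 1 act_modZ.
Proof. exact: (act1 r). Qed.
Lemma act_modZDr : right_distributive act_modZ +%R.
Proof. exact: (actDr r). Qed.
Lemma act_modZDl z : {morph act_modZ^~ z : a b / a + b}.
Proof. by move=> a b; exact: (actDl r a b z). Qed.

HB.instance Definition _ := GRing.Zmodule_isLmodule.Build R (act_mod r)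
  act_modZA act_mod1Z act_modZDr act_modZDl.

End ActionModule.

Section RingUnit.
Variables (X : topologicalType) (T : ringPresheaf X).

Lemma ring_unit_local (U : opens X) (s : ring_sheafify T U) x :
  oset U x -> exists (W : opens X) (h : W `<=` U) (t : T W),
    oset W x /\ rres (ring_sheafify T) h s = ring_unit T W t.
Proof. exact: (@sh_unit_local X (psh_of_z (z_of_ring T)) U s x). Qed.

Lemma ring_unit_local2 (U : opens X) (s s' : ring_sheafify T U) x :
  oset U x -> exists (W : opens X) (h : W `<=` U) (t t' : T W),
    [/\ oset W x, rres (ring_sheafify T) h s = ring_unit T W t &
        rres (ring_sheafify T) h s' = ring_unit T W t'].
Proof.
move=> Ux; have [W [h [t [Wx e]]]] := ring_unit_local s Ux.
have [W' [h' [t' [Wx' e']]]] := ring_unit_local s' Ux.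
exists (openI W W'), (subset_trans (@openIl _ W W') h).
exists (rres T (@openIl _ W W') t), (rres T (@openIr _ W W') t'); split=> //.
  by rewrite -(rres_comp h (@openIl _ W W')) e rhom_res.
by rewrite -(rres_comp h' (@openIr _ W W')) e' rhom_res.
Qed.

End RingUnit.

Section SheafifyAction.
Variables (X : topologicalType) (T : ringPresheaf X) (N : zpresheaf X).
Hypothesis Nsh : is_sheaf (psh_of_z N).
Variable r : forall U, ring_action (T U) (N U).
Hypothesis r_res : forall (U V : opens X) (h : V `<=` U) t n,
  zres N h (act (r U) t n) = act (r V) (rres T h t) (zres N h n).

Let S := ring_sheafify T.

Lemma z_eq_local (U : opens X) (s t : N U) :
  (forall x, oset U x ->
    exists (W : opens X) (h : W `<=` U), oset W x /\ zres N h s = zres N h t) ->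
  s = t.
Proof. exact: (sheaf_eq_local Nsh). Qed.

(** Only the scalars are sheafified: near each point [a] comes from [T], and the local actions on
    the restrictions of [n] glue because [N] is a sheaf. *)
Lemma shact_ex (U : opens X) (a : S U) (n : N U) : exists n' : N U,
  forall (W : opens X) (h : W `<=` U) (t : T W),
    rres S h a = ring_unit T W t -> zres N h n' = act (r W) t (zres N h n).
Proof.
have nf (W V : opens X) (hW : W `<=` U) (hV : V `<=` U) (h : V `<=` W) t :
    zres N h (act (r W) t (zres N hW n)) = act (r V) (rres T h t) (zres N hV n).
  by rewrite r_res (zres_comp _ _ hV).
exact: (@sh_extend X (psh_of_z (z_of_ring T)) (psh_of_z N) Nsh U
  (fun W hW t => act (r W) t (zres N hW n)) nf a).
Qed.

Definition shact U (a : S U) (n : N U) : N U := projT1 (cid (shact_ex a n)).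

Lemma shact_local (U W : opens X) (h : W `<=` U) (a : S U) n t :
  rres S h a = ring_unit T W t -> zres N h (shact a n) = act (r W) t (zres N h n).
Proof. by rewrite /shact; case: cid => n' /= /[apply]. Qed.

Lemma shact_res (U V : opens X) (h : V `<=` U) a n :
  zres N h (shact a n) = shact (rres S h a) (zres N h n).
Proof.
apply: z_eq_local => x Vx.
have [W [k [t [Wx e]]]] := ring_unit_local (rres S h a) Vx.
exists W, k; split=> //; rewrite (shact_local _ e).
rewrite !(zres_comp _ _ (subset_trans k h)); apply: shact_local.
by rewrite -e (rres_comp _ _ (subset_trans k h)).
Qed.

Lemma shact_unit U t n : shact (ring_unit T U t) n = act (r U) t n.
Proof.
have := @shact_local U U (@subset_refl _ U) (ring_unit T U t) n t.
by rewrite !zres_id; apply; rewrite rres_id.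
Qed.

(** Each axiom is an equality in the sheaf [N]; near a point the scalars come from [T], where it is
    an axiom of [r]. *)
Definition shact_action U : ring_action (S U) (N U).
Proof.
refine (@RingAction (S U) (N U) (@shact U) _ _ _ _).
- move=> a b n; apply: z_eq_local => x Ux.
  have [W [h [s [t [Wx ea eb]]]]] := ring_unit_local2 a b Ux.
  exists W, h; split=> //; rewrite !shact_res rmorphM ea eb -rmorphM.
  by rewrite !shact_unit actA.
- by move=> n; rewrite -(rmorph1 (ring_unit T U)) shact_unit act1.
- move=> a y z; apply: z_eq_local => x Ux.
  have [W [h [s [Wx ea]]]] := ring_unit_local a Ux.
  by exists W, h; split=> //; rewrite raddfD !shact_res raddfD ea !shact_unit actDr.
- move=> a b z; apply: z_eq_local => x Ux.
  have [W [h [s [t [Wx ea eb]]]]] := ring_unit_local2 a b Ux.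
  exists W, h; split=> //; rewrite raddfD !shact_res rmorphD ea eb -rmorphD.
  by rewrite !shact_unit actDl.
Defined.

Definition shact_psh : modPresheaf S :=
  @ModPresheaf X S (fun U => act_mod (shact_action U)) (fun U V h => zres N h)
    shact_res (@zres_id X N) (@zres_comp X N).

Definition shact_mod : modSheaf S := @ModSheaf X S shact_psh Nsh.

End SheafifyAction.

Section FixedMap.
Variables (X : topologicalType) (A : ringSheaf X) (L L' : modSheaf A).
Variables (p : modHom L L) (p' : modHom L' L') (f : modHom L L').
Hypothesis fp : forall U s, f U (p U s) = p' U (f U s).

Lemma fixed_fun_subproof U (s : fixed_mod p U) :
  f U (fixed_val s) \in @fixed_pred _ _ _ p' U.
Proof. by apply/asboolP; rewrite -fp fixedE. Qed.

Definition fixed_fun U (s : fixed_mod p U) : fixed_mod p' U :=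
  FixedSec (fixed_fun_subproof s).

Lemma fixed_fun_linear U : linear (@fixed_fun U).
Proof. by move=> a s t; apply: val_inj; exact: (linearP (f U)). Qed.

HB.instance Definition _ U := GRing.isLinear.Build (A U) (fixed_mod p U) (fixed_mod p' U) _
  (@fixed_fun U) (@fixed_fun_linear U).

Definition fixed_map : modHom (fixed_mod p) (fixed_mod p').
Proof.
refine (@ModHom X A (fixed_mod p) (fixed_mod p') (fun U => @fixed_fun U) _).
by move=> U V h s; apply: val_inj; exact: (mhom_res f).
Defined.

End FixedMap.

(** * Generators of the twisted algebra *)

Section TensorAlgebraGenerators.
Variables (B : pzRingType) (M : bimod B).

Definition talg_base (b : B) : talg M := tgen (TB M b).

Lemma talg_base_additive : zmod_morphism talg_base.
Proof.
(* The additivity relation for the sum [(b - c) + c] gives compatibility with differences. *)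
move=> b c; have := tgenDB [::] (b - c) c => /=.
by rewrite subrK => e; rewrite /talg_base [in RHS]e addrK.
Qed.
Lemma talg_base_monoid : monoid_morphism talg_base.
Proof. by split=> // b c; rewrite [RHS]tmul_gen. Qed.
HB.instance Definition _ := GRing.isZmodMorphism.Build B (talg M) talg_base
  talg_base_additive.
HB.instance Definition _ := GRing.isMonoidMorphism.Build B (talg M) talg_base
  talg_base_monoid.

Definition talg_arrow (m : M) : talg M := tgen (TM m (TB M 1)).

Lemma talg_arrow_additive : zmod_morphism talg_arrow.
Proof.
move=> m n; have := tgenDM [::] (m - n) n (TB M 1) => /=.
by rewrite subrK => e; rewrite /talg_arrow [in RHS]e addrK.
Qed.
HB.instance Definition _ := GRing.isZmodMorphism.Build M (talg M) talg_arrow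
  talg_arrow_additive.

Lemma talg_base_arrow b m : talg_base b * talg_arrow m = talg_arrow (bl b m).
Proof. exact: tmul_gen. Qed.

(** The balancing relation moves [b] from the trailing base factor into the arrow. *)
Lemma talg_arrow_base m b : talg_arrow m * talg_base b = talg_arrow (br m b).
Proof.
rewrite [LHS]tmul_gen /= mul1r.
by rewrite /talg_arrow (tgen_bal [::]) /= mulr1.
Qed.

Lemma tgen_TM m w : tgen (TM m w) = talg_arrow m * tgen w.
Proof. by rewrite [RHS]tmul_gen /= tact1. Qed.

End TensorAlgebraGenerators.

Section TwistedAlgebra.
Variables (X : topologicalType) (O : comRingSheaf X) (Q : quiver).
Variable M : arrow Q -> modSheaf O.

Let T := talg_psh (arrow_bimod_psh M).
Let B := base_psh O Q.
Let A := twisted_algebra M.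

Definition tw_base U : {rmorphism B U -> A U} :=
  ring_unit T U \o @talg_base _ (arrow_bimod_psh M U).

Definition tw_arrow U (m : arrow_sec M U) : A U :=
  ring_unit T U (talg_arrow (m : arrow_bimod_psh M U)).

Lemma tw_arrow_additive U : zmod_morphism (@tw_arrow U).
Proof. by move=> m n; rewrite /tw_arrow !raddfB. Qed.
HB.instance Definition _ U :=
  GRing.isZmodMorphism.Build (arrow_sec M U) (A U) (@tw_arrow U) (@tw_arrow_additive U).

Lemma tw_base_arrow U (b : B U) (m : arrow_sec M U) :
  tw_base U b * tw_arrow m = tw_arrow (bl (b0 := arrow_bimod M U) b m).
Proof. by rewrite /= -rmorphM; congr (ring_unit T U _); exact: talg_base_arrow. Qed.

Lemma tw_arrow_base U (b : B U) (m : arrow_sec M U) :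
  tw_arrow m * tw_base U b = tw_arrow (br (b0 := arrow_bimod M U) m b).
Proof. by rewrite /= -rmorphM; congr (ring_unit T U _); exact: talg_arrow_base. Qed.

Lemma tw_base_res (U V : opens X) (h : V `<=` U) b :
  rres A h (tw_base U b) = tw_base V (base_res h b).
Proof.
rewrite [LHS](rhom_res (ring_unit T) h); congr (ring_unit T V _).
exact: talg_map_gen.
Qed.

Lemma tw_arrow_res (U V : opens X) (h : V `<=` U) m :
  rres A h (tw_arrow m) = tw_arrow (arrow_res h m).
Proof.
rewrite [LHS](rhom_res (ring_unit T) h); congr (ring_unit T V _).
by rewrite [LHS]talg_map_gen /= rmorph1.
Qed.

(** Generation principle: a section of [A] is locally a signed sum of words, and a word is a product
    of arrow sections ending in a base section. The last premise passes from local to global. *)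
Lemma tw_ind (P : forall U : opens X, A U -> Prop) :
  (forall U b, P U (tw_base U b)) -> (forall U m, P U (@tw_arrow U m)) ->
  (forall U a b, P U a -> P U b -> P U (a + b)) -> (forall U a, P U a -> P U (- a)) ->
  (forall U a b, P U a -> P U b -> P U (a * b)) ->
  (forall U a, (forall x, oset U x -> exists (W : opens X) (h : W `<=` U),
    oset W x /\ P W (rres A h a)) -> P U a) ->
  forall U a, P U a.
Proof.
move=> Pb Pm PD PN PM Pl U a; apply: Pl => x Ux.
have [W [h [t [Wx e]]]] := @ring_unit_local X T U a x Ux.
exists W, h; split=> //; rewrite [rres _ _ _]e {e}.
elim/talg_ind: t => [|s t ps pt|s ps|w].
(* Zero is reached as the base section 0. *)
- by rewrite rmorph0 -(rmorph0 (tw_base W)).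
- by rewrite rmorphD; exact: PD.
- by rewrite rmorphN; exact: PN.
elim: w => [b|m w IH]; first exact: Pb.
by rewrite tgen_TM rmorphM; apply: PM => //; exact: Pm.
Qed.

(** The diagonal embedding of [O] in the base algebra, sending [a] to the sum of the [a e_i];
    through it modules over [A] restrict to [O]-modules. *)
Definition base_const U (a : O U) : B U := fun=> a.
Lemma base_const_additive U : zmod_morphism (@base_const U).
Proof. by []. Qed.
Lemma base_const_monoid U : monoid_morphism (@base_const U).
Proof. by []. Qed.
HB.instance Definition _ U :=
  GRing.isZmodMorphism.Build (O U) (B U) (@base_const U) (@base_const_additive U).
HB.instance Definition _ U :=
  GRing.isMonoidMorphism.Build (O U) (B U) (@base_const U) (@base_const_monoid U).

Definition tw_const : ringHom O A.
Proof.
refine (@RingHom X O A (fun U => tw_base U \o @base_const U) _).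
by move=> U V h a; rewrite /= -[LHS]/(rres A h (tw_base U _)) tw_base_res.
Defined.

Definition idem (i : vertex Q) U : B U := fun j => (j == i)%:R.

Lemma idem_res i (U V : opens X) (h : V `<=` U) : base_res h (idem i U) = idem i V.
Proof.
by apply/funext => j; rewrite /base_res /idem; case: eqP; rewrite ?rmorph1 ?rmorph0.
Qed.

Lemma idemM i U : idem i U * idem i U = idem i U.
Proof.
apply/funext => j; rewrite -[LHS]/(idem i U j * idem i U j) /idem.
by case: eqP; rewrite ?mulr1 ?mulr0.
Qed.

Lemma idemM0 i j U : i != j -> idem i U * idem j U = 0.
Proof.
move=> ij; apply/funext => k; rewrite -[LHS]/(idem i U k * idem j U k) /idem.
case: eqP => [->|_]; last by rewrite mul0r.
by rewrite (negbTE ij) mulr0.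
Qed.

Lemma sum_idem U : \sum_i idem i U = 1.
Proof.
apply/funext => j.
rewrite fct_sumE (bigD1 j) //= big1 ?addr0 /idem ?eqxx // => i ij.
by rewrite eq_sym (negbTE ij).
Qed.

(** The inclusion of the summand at [a]: [dfwith] replaces the entry at [a] in the zero family. *)
Definition arrow_in a U (m : M a U) : arrow_sec M U :=
  @eqtype.dfwith _ (fun a => M a U : Type) (fun=> 0) a m.

Lemma arrow_in_additive a U : zmod_morphism (@arrow_in a U).
Proof.
move=> m n; apply: arrow_ext => c.
rewrite -[RHS]/(arrow_in m c - arrow_in n c) /arrow_in.
have [<-|ac] := eqVneq a c; first by rewrite !dfwith_in.
by rewrite !dfwith_out// subr0.
Qed.
HB.instance Definition _ a U :=
  GRing.isZmodMorphism.Build (M a U) (arrow_sec M U) (@arrow_in a U)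
    (@arrow_in_additive a U).

Lemma arrow_in_res a (U V : opens X) (h : V `<=` U) (m : M a U) :
  arrow_res h (arrow_in m) = arrow_in (mres (M a) h m).
Proof.
apply: arrow_ext => c; rewrite /arrow_res /arrow_in.
have [<-|ac] := eqVneq a c; first by rewrite !dfwith_in.
by rewrite !dfwith_out// raddf0.
Qed.

Lemma bl_arrow_in a U (b : B U) (m : M a U) :
  bl (b0 := arrow_bimod M U) b (arrow_in m) = arrow_in (b (head a) *: m).
Proof.
apply: arrow_ext => c; rewrite /= /arrow_in.
have [<-|ac] := eqVneq a c; first by rewrite !dfwith_in.
by rewrite !dfwith_out// scaler0.
Qed.

Lemma br_arrow_in a U (b : B U) (m : M a U) :
  br (b0 := arrow_bimod M U) (arrow_in m) b = arrow_in (b (tail a) *: m).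
Proof.
apply: arrow_ext => c; rewrite /= /arrow_in.
have [<-|ac] := eqVneq a c; first by rewrite !dfwith_in.
by rewrite !dfwith_out// scaler0.
Qed.

Lemma arrow_sum U (m : arrow_sec M U) : m = \sum_a arrow_in (m a).
Proof.
have E (f : arrow Q -> arrow_sec M U) c : (\sum_a f a) c = \sum_a f a c.
  by elim/big_ind2: _ => // x1 x2 y1 y2 <- <-.
apply: arrow_ext => c; rewrite E (bigD1 c) //= big1 => [|i ic].
  by rewrite addr0 /arrow_in dfwith_in.
by rewrite /arrow_in dfwith_out.
Qed.

End TwistedAlgebra.

Lemma modHom_compE (X : topologicalType) (A : ringPresheaf X) (L M N : modPresheaf A)
  (g : modHom M N) (f : modHom L M) U s : modHom_comp g f U s = g U (f U s).
Proof. by []. Qed.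

(** * From modules to representations *)

Section RepOfModule.
Variables (X : topologicalType) (O : comRingSheaf X) (Q : quiver).
Variable M : arrow Q -> modSheaf O.

Let B := base_psh O Q.
Let A := twisted_algebra M.
Let c : ringHom O A := tw_const M.
Implicit Types (i j : vertex Q) (al : arrow Q) (U V : opens X).

(** Commutativity of [O] gives this; it makes multiplication by the idempotents [O]-linear. *)
Lemma tw_const_base U (a : O U) (b : B U) : c U a * tw_base M U b = tw_base M U b * c U a.
Proof.
rewrite -[c U a]/(tw_base M U (base_const (Q := Q) a)) -!rmorphM; congr (tw_base M U _).
by apply/funext => i; exact: com_mulC.
Qed.

(** Both products agree since a constant function has the same value at the head and at the tail;
    hence an arrow acts [O]-linearly. *)
Lemma tw_const_arrow U (a : O U) al (m : M al U) :
  c U a * tw_arrow (arrow_in m) = tw_arrow (arrow_in (a *: m)) /\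
  tw_arrow (arrow_in m) * c U a = tw_arrow (arrow_in (a *: m)).
Proof.
rewrite -[c U a]/(tw_base M U (base_const (Q := Q) a)) tw_base_arrow bl_arrow_in.
by rewrite tw_arrow_base br_arrow_in.
Qed.

Lemma tw_idem_arrow U al (m : M al U) :
  tw_base M U (idem O (head al) U) * tw_arrow (arrow_in m) = tw_arrow (arrow_in m).
Proof. by rewrite tw_base_arrow bl_arrow_in /idem eqxx scale1r. Qed.

Lemma tw_arrow_idem U al (m : M al U) :
  tw_arrow (arrow_in m) * tw_base M U (idem O (tail al) U) = tw_arrow (arrow_in m).
Proof. by rewrite tw_arrow_base br_arrow_in /idem eqxx scale1r. Qed.

Lemma tw_idem_res i U V (h : V `<=` U) :
  rres A h (tw_base M U (idem O i U)) = tw_base M V (idem O i V).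
Proof. by rewrite tw_base_res; congr (tw_base M V _); exact: idem_res. Qed.

Section Objects.
Variable N : modSheaf A.

Let L := restr_mod c N.

Definition vtx_fun i U (s : L U) : L U := tw_base M U (idem O i U) *: (s : N U).

Lemma vtx_fun_linear i U : linear (@vtx_fun i U).
Proof.
move=> a s t; rewrite /vtx_fun scalerDr; congr (_ + _).
by rewrite -[a *: s]/(c U a *: (s : N U)) !scalerA -tw_const_base -scalerA.
Qed.
HB.instance Definition _ i U := GRing.isLinear.Build (O U) (L U) (L U) _
  (@vtx_fun i U) (@vtx_fun_linear i U).

Definition vtx_proj i : modHom L L.
Proof.
refine (@ModHom X O L L (fun U => @vtx_fun i U) _).
move=> U V h s; rewrite -[LHS]/(mres N h (tw_base M U (idem O i U) *: (s : N U))).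
by rewrite [LHS]mresZ tw_idem_res.
Defined.

(** The summand [e_i N], which consists of the sections fixed by [e_i] because [e_i] is
    idempotent. *)
Definition vtx_mod i : modSheaf O := fixed_mod (vtx_proj i).

Definition vtx_val i U (s : vtx_mod i U) : N U := fixed_val s.

Lemma vtx_valE i U (s : vtx_mod i U) : tw_base M U (idem O i U) *: vtx_val s = vtx_val s.
Proof. exact: (fixedE s). Qed.

Lemma vtx_val_inj i U : injective (@vtx_val i U).
Proof. exact: val_inj. Qed.

Lemma vtx_sub_subproof i U (s : N U) : tw_base M U (idem O i U) *: s = s ->
   s \in @fixed_pred _ _ L (vtx_proj i) U.
Proof. by move=> e; apply/asboolP. Qed.

Definition vtx_sub i U (s : N U) (e : tw_base M U (idem O i U) *: s = s) : vtx_mod i U :=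
  FixedSec (vtx_sub_subproof e).

Lemma vtx_val_sub i U s e : vtx_val (@vtx_sub i U s e) = s.
Proof. by []. Qed.

Lemma vtx_val_additive i U : zmod_morphism (@vtx_val i U).
Proof. by []. Qed.
HB.instance Definition _ i U := GRing.isZmodMorphism.Build (vtx_mod i U) (N U)
  (@vtx_val i U) (@vtx_val_additive i U).

Lemma vtx_valZ i U a (s : vtx_mod i U) : vtx_val (a *: s) = c U a *: vtx_val s.
Proof. by []. Qed.

Lemma vtx_val_res i U V (h : V `<=` U) (s : vtx_mod i U) :
  vtx_val (mres (vtx_mod i) h s) = mres N h (vtx_val s).
Proof. by []. Qed.

Lemma vtx_act_subproof al U (m : M al U) (s : N U) :
  tw_base M U (idem O (head al) U) *: (tw_arrow (arrow_in m) *: s) =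
  tw_arrow (arrow_in m) *: s.
Proof. by rewrite scalerA tw_idem_arrow. Qed.

Definition vtx_act al U (m : M al U) (s : vtx_mod (tail al) U) : vtx_mod (head al) U :=
  vtx_sub (vtx_act_subproof m (vtx_val s)).

Lemma vtx_val_act al U (m : M al U) s :
  vtx_val (vtx_act m s) = tw_arrow (arrow_in m) *: vtx_val s.
Proof. exact: vtx_val_sub. Qed.

Lemma vtx_actDl al U (m m' : M al U) s : vtx_act (m + m') s = vtx_act m s + vtx_act m' s.
Proof.
by apply: vtx_val_inj; rewrite [RHS]raddfD !vtx_val_act !raddfD scalerDl.
Qed.
Lemma vtx_actDr al U (m : M al U) s s' : vtx_act m (s + s') = vtx_act m s + vtx_act m s'.
Proof.
by apply: vtx_val_inj; rewrite [RHS]raddfD !vtx_val_act [vtx_val (s + s')]raddfD scalerDr.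
Qed.
Lemma vtx_actZl al U a (m : M al U) s : vtx_act (a *: m) s = a *: vtx_act m s.
Proof.
apply: vtx_val_inj; rewrite vtx_valZ !vtx_val_act scalerA.
by rewrite (tw_const_arrow a m).1.
Qed.
Lemma vtx_actZr al U a (m : M al U) s : vtx_act m (a *: s) = a *: vtx_act m s.
Proof.
apply: vtx_val_inj; rewrite vtx_valZ !vtx_val_act vtx_valZ !scalerA.
by rewrite (tw_const_arrow a m).1 (tw_const_arrow a m).2.
Qed.
Lemma vtx_act_res al U V (h : V `<=` U) (m : M al U) s :
  mres (vtx_mod (head al)) h (vtx_act m s) =
  vtx_act (mres (M al) h m) (mres (vtx_mod (tail al)) h s).
Proof.
apply: vtx_val_inj; rewrite vtx_val_res !vtx_val_act vtx_val_res.
by rewrite mresZ tw_arrow_res arrow_in_res.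
Qed.

Definition rep_of_mod : twisted_rep M :=
  @TwistedRep X O Q M vtx_mod (fun al => tensor_lift (@vtx_actDl al) (@vtx_actDr al)
     (@vtx_actZl al) (@vtx_actZr al) (@vtx_act_res al)).

Lemma rep_of_mod_map al U (m : M al U) s :
  rep_map rep_of_mod al U (tensor_pure m s) = vtx_act m s.
Proof. exact: tensor_lift_pure. Qed.

Lemma vtx_comp_subproof i U (s : N U) :
  tw_base M U (idem O i U) *: (tw_base M U (idem O i U) *: s) =
  tw_base M U (idem O i U) *: s.
Proof. by rewrite scalerA -rmorphM idemM. Qed.

Definition vtx_comp i U (s : N U) : vtx_mod i U := vtx_sub (vtx_comp_subproof i s).

Lemma vtx_val_comp i U s : vtx_val (@vtx_comp i U s) = tw_base M U (idem O i U) *: s.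
Proof. exact: vtx_val_sub. Qed.

Lemma vtx_comp_additive i U : zmod_morphism (@vtx_comp i U).
Proof.
by move=> s t; apply: vtx_val_inj; rewrite [RHS]raddfB !vtx_val_comp scalerBr.
Qed.
HB.instance Definition _ i U := GRing.isZmodMorphism.Build (N U) (vtx_mod i U)
  (@vtx_comp i U) (@vtx_comp_additive i U).

(** Expand the unit of the algebra as the sum of the [e_i]. *)
Lemma vtx_decomp U (s : N U) : s = \sum_i vtx_val (vtx_comp i s).
Proof.
rewrite -[LHS]scale1r -(rmorph1 (tw_base M U)) -sum_idem rmorph_sum scaler_suml.
by apply: eq_bigr => i _; rewrite vtx_val_comp.
Qed.

Lemma vtx_comp_res i U V (h : V `<=` U) s :
  mres (vtx_mod i) h (vtx_comp i s) = vtx_comp i (mres N h s).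
Proof. by apply: vtx_val_inj; rewrite vtx_val_res !vtx_val_comp mresZ tw_idem_res. Qed.

(** In the base algebra [e_i b = b_i e_i]. With the next two lemmas this describes the generators of
    [A] in components, as needed for the linearity of glued morphisms. *)
Lemma vtx_comp_base i U (b : B U) s :
  vtx_comp i (tw_base M U b *: s) = b i *: vtx_comp i s.
Proof.
apply: vtx_val_inj; rewrite vtx_valZ !vtx_val_comp !scalerA.
rewrite -[c U _]/(tw_base M U (base_const (Q := Q) (b i))) -!rmorphM.
congr (tw_base M U _ *: s); apply/funext => j.
rewrite -[LHS]/(idem O i U j * b j) -[RHS]/(b i * idem O i U j) /idem.
by case: eqP => [->|_]; rewrite ?(mul0r,mul1r,mulr0,mulr1).
Qed.

(** Multiplying an element of the summand at [al] by the idempotent of its head on the left, or of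
    its tail on the right, changes nothing. *)
Lemma vtx_comp_arrow al U (m : M al U) s :
  vtx_comp (head al) (tw_arrow (arrow_in m) *: s) = vtx_act m (vtx_comp (tail al) s).
Proof.
apply: vtx_val_inj; rewrite vtx_val_act !vtx_val_comp !scalerA tw_idem_arrow.
by rewrite tw_arrow_idem.
Qed.

Lemma vtx_comp_arrow0 i al U (m : M al U) s : i != head al ->
  vtx_comp i (tw_arrow (arrow_in m) *: s) = 0.
Proof.
move=> ne; apply: vtx_val_inj; rewrite vtx_val_comp scalerA tw_base_arrow bl_arrow_in.
by rewrite /idem eq_sym (negbTE ne) scale0r !raddf0 scale0r.
Qed.

Lemma vtx_comp_val i U (s : vtx_mod i U) : vtx_comp i (vtx_val s) = s.
Proof. by apply: vtx_val_inj; rewrite vtx_val_comp vtx_valE. Qed.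

Lemma vtx_comp_val0 i j U (s : vtx_mod i U) : j != i -> vtx_comp j (vtx_val s) = 0.
Proof.
move=> ne; apply: vtx_val_inj; rewrite vtx_val_comp raddf0 -vtx_valE scalerA -rmorphM.
by rewrite idemM0// rmorph0 scale0r.
Qed.

End Objects.

(** * Full faithfulness of the functor to representations *)

Section Morphisms.
Variables (N N' : modSheaf A).

Lemma vtx_map_subproof (f : modHom N N') i U s :
  restr_hom c f U (vtx_proj N i U s) = vtx_proj N' i U (restr_hom c f U s).
Proof. exact: (linearZZ (f U) (tw_base M U (idem O i U)) (s : N U)). Qed.

Definition rep_of_hom (f : modHom N N') : rep_hom (rep_of_mod N) (rep_of_mod N').
Proof.
refine (@RepHom X O Q M (rep_of_mod N) (rep_of_mod N')
  (fun i => fixed_map (@vtx_map_subproof f i)) _).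
move=> al; apply: tensor_ext => U m v.
rewrite !modHom_compE tensor_map_pure !rep_of_mod_map.
apply: vtx_val_inj; rewrite vtx_val_act.
exact: (linearZZ (f U) (tw_arrow (arrow_in m)) (vtx_val v)).
Defined.

Lemma rep_of_hom_val (f : modHom N N') i U (s : vtx_mod N i U) :
  vtx_val (rep_fun (rep_of_hom f) i U s) = f U (vtx_val s).
Proof. by []. Qed.

(** By [vtx_decomp] a morphism is determined by its values on the summands [e_i N]. *)
Lemma rep_of_hom_inj : injective rep_of_hom.
Proof.
move=> f g e; apply: modHom_ext => U s.
rewrite [s]vtx_decomp !raddf_sum; apply: eq_bigr => i _.
rewrite -[LHS](rep_of_hom_val f) e; exact: rep_of_hom_val.
Qed.

Variable g : rep_hom (rep_of_mod N) (rep_of_mod N').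

(** The direct sum of the components of [g]; it is shown below to be [A]-linear and a preimage of
    [g]. *)
Definition glue_fun U (s : N U) : N' U :=
  \sum_i vtx_val (rep_fun g i U (vtx_comp i s)).

Lemma glue_fun_additive U : zmod_morphism (@glue_fun U).
Proof.
move=> s t; rewrite /glue_fun -sumrB; apply: eq_bigr => i _.
by rewrite !raddfB.
Qed.

HB.instance Definition _ U := GRing.isZmodMorphism.Build (N U) (N' U)
  (@glue_fun U) (@glue_fun_additive U).

Lemma glue_funD U (s t : N U) : glue_fun (s + t) = glue_fun s + glue_fun t.
Proof. exact: raddfD. Qed.
Lemma glue_funN U (s : N U) : glue_fun (- s) = - glue_fun s.
Proof. exact: raddfN. Qed.

Lemma glue_fun_res (U V : opens X) (h : V `<=` U) s :
  mres N' h (glue_fun s) = glue_fun (mres N h s).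
Proof.
rewrite raddf_sum; apply: eq_bigr => i _.
rewrite -vtx_comp_res -(mhom_res (rep_fun g i)).
by [].
Qed.

Lemma glue_fun_comp U (s : N U) i : vtx_comp i (glue_fun s) = rep_fun g i U (vtx_comp i s).
Proof.
rewrite raddf_sum (bigD1 i) //= vtx_comp_val big1 ?addr0 // => j ji.
by rewrite vtx_comp_val0// eq_sym.
Qed.

Lemma vtx_comp_inj U (s t : N' U) : (forall i, vtx_comp i s = vtx_comp i t) -> s = t.
Proof.
move=> e; rewrite [s]vtx_decomp [t]vtx_decomp.
by apply: eq_bigr => i _; rewrite e.
Qed.

Lemma rep_fun_act al U (m : M al U) s :
  rep_fun g (head al) U (vtx_act m s) = vtx_act m (rep_fun g (tail al) U s).
Proof.
have /(congr1 (fun f : modHom _ _ => f U (tensor_pure m s))) := rep_funP g al.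
by rewrite !modHom_compE tensor_map_pure !rep_of_mod_map.
Qed.

(** Induction on the scalar by [tw_ind]: base sections act on components through [O], arrows commute
    with [g] by [rep_fun_act], and the remaining closure properties are formal or local. *)
Lemma glue_fun_scalable U : scalable (@glue_fun U).
Proof.
move=> a s; move: U a s; apply: tw_ind.
- move=> U b s; apply: vtx_comp_inj => i.
  by rewrite glue_fun_comp !vtx_comp_base glue_fun_comp linearZ.
- move=> U m s; rewrite [m]arrow_sum raddf_sum !scaler_suml raddf_sum.
  apply: eq_bigr => al _; apply: vtx_comp_inj => i; rewrite glue_fun_comp.
  (* The product with an arrow in the summand at [al] lives only in the component at [head al]. *)
  have [->|ne] := eqVneq i (head al).
    by rewrite !vtx_comp_arrow rep_fun_act glue_fun_comp.
  by rewrite !vtx_comp_arrow0// raddf0.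
- by move=> U a b ha hb s; rewrite !scalerDl glue_funD ha hb.
- by move=> U a ha s; rewrite !scaleNr glue_funN ha.
- by move=> U a b ha hb s; rewrite -!scalerA ha hb.
- move=> U a loc s; apply: mod_eq_local => x /loc [W [h [Wx e]]].
  by exists W, h; split=> //; rewrite mresZ !glue_fun_res mresZ e.
Qed.

HB.instance Definition _ U := GRing.isScalable.Build (A U) (N U) (N' U) _
  (@glue_fun U) (@glue_fun_scalable U).

Definition glue_hom : modHom N N' :=
  @ModHom X A N N' (fun U => @glue_fun U) glue_fun_res.

Lemma glue_homK : rep_of_hom glue_hom = g.
Proof.
apply: rep_hom_ext => i; apply: modHom_ext => U s.
apply: vtx_val_inj; rewrite [LHS]rep_of_hom_val.
(* A section of [e_i N] has only its [i]-th component. *)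
rewrite [LHS](bigD1 i)// vtx_comp_val big1 => [|j ji]; first exact: addr0.
by rewrite vtx_comp_val0// !raddf0.
Qed.

End Morphisms.

Definition rep_functor : functor (modCat A) (repCat M).
Proof.
refine (@Functor (modCat A) (repCat M) rep_of_mod rep_of_hom _ _).
- move=> N; apply: rep_hom_ext => i; apply: modHom_ext => U s.
  exact: val_inj.
- move=> N N' N'' g f; apply: rep_hom_ext => i; apply: modHom_ext => U s.
  exact: val_inj.
Defined.

Lemma rep_functor_ff : fully_faithful rep_functor.
Proof.
move=> N N'; apply: inj_surj_bij => [|g]; first exact: rep_of_hom_inj.
by exists (glue_hom g); exact: glue_homK.
Qed.

End RepOfModule.

(** * From representations to modules *)

Section TensorAlgebraAction.
Variables (B : pzRingType) (M : bimod B) (Z : zmodType) (ba : ring_action B Z).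
Variable ma : M -> Z -> Z.
Hypothesis maDl : forall m n z, ma (m + n) z = ma m z + ma n z.
Hypothesis maDr : forall m y z, ma m (y + z) = ma m y + ma m z.
Hypothesis ma_bl : forall b m z, ma (bl b m) z = act ba b (ma m z).
Hypothesis ma_br : forall m b z, ma (br m b) z = ma m (act ba b z).

Fixpoint word_act (w : tword M) (z : Z) : Z :=
  match w with TB b => act ba b z | TM m w' => ma m (word_act w' z) end.

Lemma word_act_tact b w z : word_act (tact b w) z = act ba b (word_act w z).
Proof. by case: w => [c|m w] /=; rewrite ?actA ?ma_bl. Qed.

Lemma word_act_tcat u w z : word_act (tcat u w) z = word_act u (word_act w z).
Proof. by elim: u => [b|m u IH] /=; rewrite ?word_act_tact ?IH. Qed.

Lemma word_actD w y z : word_act w (y + z) = word_act w y + word_act w z.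
Proof. by elim: w => [b|m w IH] /=; rewrite ?actDr ?IH ?maDr. Qed.

(** The letters of the common prefix act additively and peel off by induction; what remains is
    additivity of the base and arrow actions, or balancing. *)
Lemma talg_act_rel (z : Z) s t : @talg_rel B M s t ->
  feval (word_act^~ z) s = feval (word_act^~ z) t.
Proof.
case=> [p b b'|p m m' w|p m b w] /=; elim: p => [|n p IH] //=; rewrite ?IH ?maDr//.
- exact: actDl.
- by rewrite word_act_tact ma_br.
Qed.

Definition talg_act (x : talg M) (z : Z) : Z := pext (talg_act_rel z) x.

Lemma talg_act_gen w z : talg_act (tgen w) z = word_act w z.
Proof. exact: pext_gen. Qed.

Lemma talg_actDl x y z : talg_act (x + y) z = talg_act x z + talg_act y z.
Proof. exact: (raddfD (pext (talg_act_rel z))). Qed.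
Lemma talg_act0l z : talg_act 0 z = 0.
Proof. exact: (raddf0 (pext (talg_act_rel z))). Qed.
Lemma talg_actNl x z : talg_act (- x) z = - talg_act x z.
Proof. exact: (raddfN (pext (talg_act_rel z))). Qed.

Lemma talg_actDr x y z : talg_act x (y + z) = talg_act x y + talg_act x z.
Proof.
elim/talg_ind: x => [|u v eu ev|u eu|w].
- by rewrite !talg_act0l addr0.
- by rewrite !talg_actDl eu ev addrACA.
- by rewrite !talg_actNl eu opprD.
- by rewrite !talg_act_gen word_actD.
Qed.

Lemma talg_act0r x : talg_act x 0 = 0.
Proof. by apply: (addrI (talg_act x 0)); rewrite -talg_actDr !addr0. Qed.
Lemma talg_actNr x z : talg_act x (- z) = - talg_act x z.
Proof. by apply: (addrI (talg_act x z)); rewrite -talg_actDr !subrr talg_act0r. Qed.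

Lemma talg_actA x y z : talg_act x (talg_act y z) = talg_act (x * y) z.
Proof.
elim/talg_ind: x => [|u v eu ev|u eu|u].
- by rewrite mul0r !talg_act0l.
- by rewrite mulrDl !talg_actDl eu ev.
- by rewrite mulNr !talg_actNl eu.
elim/talg_ind: y => [|x y ex ey|x ex|w].
- by rewrite mulr0 talg_act0l talg_act0r.
- by rewrite mulrDr !talg_actDl talg_actDr ex ey.
- by rewrite mulrN !talg_actNl talg_actNr ex.
by rewrite [_ * _]tmul_gen !talg_act_gen word_act_tcat.
Qed.

Lemma talg_act1 z : talg_act 1 z = z.
Proof. by rewrite talg_act_gen /= act1. Qed.

Definition talg_action : ring_action (talg M) Z :=
  RingAction talg_actA talg_act1 talg_actDr talg_actDl.

End TensorAlgebraAction.

Section TensorPure.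
Variables (X : topologicalType) (O : comRingSheaf X) (M V : modSheaf O).
Implicit Types U : opens X.

Lemma tensor_pureDl U (m m' : M U) (v : V U) :
  tensor_pure (m + m') v = tensor_pure m v + tensor_pure m' v.
Proof. by rewrite /tensor_pure pureDl raddfD. Qed.
Lemma tensor_pureDr U (m : M U) (v v' : V U) :
  tensor_pure m (v + v') = tensor_pure m v + tensor_pure m v'.
Proof. by rewrite /tensor_pure pureDr raddfD. Qed.
Lemma tensor_pureZl U a (m : M U) (v : V U) :
  tensor_pure (a *: m) v = a *: tensor_pure m v.
Proof.
rewrite -[RHS](linearZZ (mod_unit (tens_psh M V) U)) /tensor_pure.
by congr (mod_unit _ _ _); rewrite -tensZ_pure.
Qed.
Lemma tensor_pureZr U a (m : M U) (v : V U) :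
  tensor_pure m (a *: v) = a *: tensor_pure m v.
Proof. by rewrite -tensor_pureZl /tensor_pure pure_bal. Qed.
Lemma tensor_pure0l U (v : V U) : tensor_pure (0 : M U) v = 0.
Proof. by rewrite -(scale0r 0) tensor_pureZl scale0r. Qed.
Lemma tensor_pure_res (U W : opens X) (h : W `<=` U) (m : M U) (v : V U) :
  mres (tensor M V) h (tensor_pure m v) = tensor_pure (mres M h m) (mres V h v).
Proof. by rewrite /tensor_pure mhom_res /= tens_res_pure. Qed.

End TensorPure.

(* [arrow_sec] over this quiver is the direct sum of a family indexed by the vertices
   of Q; its left action [bl] multiplies the component at [i] by [b i]. *)
Definition loops (Q : quiver) : quiver := Quiver (@id (vertex Q)) id.

Section ModuleOfRep.
Variables (X : topologicalType) (O : comRingSheaf X) (Q : quiver).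
Variables (M : arrow Q -> modSheaf O) (V : twisted_rep M).
Implicit Types (i j : vertex Q) (al : arrow Q) (U W : opens X).

Let Z U := arrow_sec (Q := loops Q) (rep_mod V) U.
Let T := talg_psh (arrow_bimod_psh M).

Definition rep_sum : zpresheaf X.
Proof.
refine (@ZPresheaf X Z (fun U W h => arrow_res h) _ _).
- by move=> U h m; apply: arrow_ext => a; exact: mres_id.
- by move=> U V' W hVU hWV hWU m; apply: arrow_ext => a; exact: mres_comp.
Defined.

Lemma rep_sum_sheafP : is_sheaf (psh_of_z rep_sum).
Proof.
move=> U C W hW cov; split=> [s t e|s e].
  apply: arrow_ext => i; apply: (proj1 (@mod_sheafP X O (rep_mod V i) U C W hW cov)) => k.
  exact: (congr1 (fun u : Z _ => u i) (e k)).
have glue i : exists t : rep_mod V i U, forall k, mres (rep_mod V i) (hW k) t = s k i.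
  apply: (proj2 (@mod_sheafP X O (rep_mod V i) U C W hW cov) (fun k => s k i)) => k l.
  exact: (congr1 (fun u : Z _ => u i) (e k l)).
exists (fun i => projT1 (cid (glue i))) => k; apply: arrow_ext => i.
by rewrite /= /arrow_res; case: cid.
Qed.

(** The left half of the bimodule over [loops Q]; that quiver has the vertices of [Q], so its base
    algebra is the same by conversion. *)
Definition rep_base_action U : ring_action (base_psh O Q U) (Z U).
Proof.
pose N := @arrow_bimod X O (loops Q) (rep_mod V) U.
exact: (RingAction (@blA _ N) (@bl1 _ N) (@blDr _ N) (@blDl _ N)).
Defined.

(** Each arrow takes the component at its tail to its head; arrows with the same head contribute a
    sum there. *)
Definition rep_arrow_act U (m : arrow_bimod M U) (z : Z U) : Z U :=
  \sum_al @arrow_in X O (loops Q) (rep_mod V) (head al) U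
     (rep_map V al U (tensor_pure (m al) (z (tail al)))).

Lemma rep_arrow_actDl U m n (z : Z U) :
  rep_arrow_act (m + n) z = rep_arrow_act m z + rep_arrow_act n z.
Proof.
rewrite -big_split; apply: eq_bigr => al _.
by rewrite -[(m + n) al]/(m al + n al) tensor_pureDl !raddfD.
Qed.

Lemma rep_arrow_actDr U m (y z : Z U) :
  rep_arrow_act m (y + z) = rep_arrow_act m y + rep_arrow_act m z.
Proof.
rewrite -big_split; apply: eq_bigr => al _.
by rewrite -[(y + z) _]/(y (tail al) + z (tail al)) tensor_pureDr !raddfD.
Qed.

(** The summand of [al] is concentrated at [head al], where [b] acts as a scalar that passes through
    the [O]-linear [rep_map]. *)
Lemma rep_arrow_act_bl U b m (z : Z U) :
  rep_arrow_act (bl b m) z = act (rep_base_action U) b (rep_arrow_act m z).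
Proof.
have actS (r : seq (arrow Q)) (F : arrow Q -> Z U) :
    act (rep_base_action U) b (\sum_(al <- r) F al) =
    \sum_(al <- r) act (rep_base_action U) b (F al).
  elim: r => [|k r IH]; last by rewrite !big_cons actDr IH.
  rewrite !big_nil; apply: (addrI (act (rep_base_action U) b 0)).
  by rewrite -actDr !addr0.
rewrite actS; apply: eq_bigr => al _.
rewrite [RHS](@bl_arrow_in X O (loops Q)); congr arrow_in.
by rewrite -linearZ -tensor_pureZl.
Qed.

(** Balancing over [O]: the scalar [b (tail al)] moves across the tensor sign. *)
Lemma rep_arrow_act_br U m b (z : Z U) :
  rep_arrow_act (br m b) z = rep_arrow_act m (act (rep_base_action U) b z).
Proof.
apply: eq_bigr => al _; congr arrow_in; congr (rep_map V al U _).
by rewrite [LHS]tensor_pureZl [RHS]tensor_pureZr.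
Qed.

Definition rep_talg_action U : ring_action (T U) (rep_sum U) :=
  talg_action (@rep_arrow_actDl U) (@rep_arrow_actDr U) (@rep_arrow_act_bl U)
    (@rep_arrow_act_br U).

Lemma rep_arrow_act_res U W (h : W `<=` U) m (z : Z U) :
  arrow_res h (rep_arrow_act m z) = rep_arrow_act (arrow_res h m) (arrow_res h z).
Proof.
rewrite raddf_sum; apply: eq_bigr => al _; rewrite [LHS](@arrow_in_res X O (loops Q)).
by congr arrow_in; rewrite mhom_res tensor_pure_res.
Qed.

Lemma rep_talg_action_res U W (h : W `<=` U) t (z : rep_sum U) :
  zres rep_sum h (act (rep_talg_action U) t z) =
  act (rep_talg_action W) (rres T h t) (zres rep_sum h z).
Proof.
elim/talg_ind: t => [|x y ex ey|x ex|w].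
- by rewrite rmorph0 /= !talg_act0l raddf0.
- by rewrite rmorphD /= !talg_actDl raddfD; congr (_ + _).
- by rewrite rmorphN /= !talg_actNl raddfN; congr (- _).
rewrite [rres _ _ _]talg_map_gen /= !talg_act_gen.
elim: w => [b|m w IH] /=; last by rewrite -IH -rep_arrow_act_res.
by apply: arrow_ext => i; exact: mresZ.
Qed.

Definition mod_of_rep : modSheaf (twisted_algebra M) :=
  shact_mod rep_sum_sheafP rep_talg_action_res.

Lemma mod_of_rep_base U b (z : mod_of_rep U) :
  tw_base M U b *: z = (fun i => b i *: (z : Z U) i) :> Z U.
Proof.
rewrite [LHS](shact_unit rep_sum_sheafP rep_talg_action_res).
by rewrite [LHS]talg_act_gen.
Qed.

Lemma mod_of_rep_arrow U m (z : mod_of_rep U) :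
  tw_arrow m *: z = rep_arrow_act m (z : Z U) :> Z U.
Proof.
rewrite [LHS](shact_unit rep_sum_sheafP rep_talg_action_res).
rewrite [LHS]talg_act_gen.
(* The word of [m] ends in the base letter 1, which acts trivially. *)
exact: (congr1 (rep_arrow_act m) (act1 (rep_base_action U) z)).
Qed.

Let N := mod_of_rep.

Definition rep_val_fun i U (s : vtx_mod N i U) : rep_mod V i U := (vtx_val s : Z U) i.

Lemma rep_val_linear i U : linear (@rep_val_fun i U).
Proof.
move=> a s t; congr (_ + _).
rewrite -[LHS]/((tw_base M U (base_const (Q := Q) a) *: vtx_val s : Z U) i).
by rewrite mod_of_rep_base.
Qed.
HB.instance Definition _ i U := GRing.isLinear.Build (O U) (vtx_mod N i U) (rep_mod V i U) _
  (@rep_val_fun i U) (@rep_val_linear i U).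

Definition rep_val i : modHom (vtx_mod N i) (rep_mod V i).
Proof.
exact: (@ModHom X O (vtx_mod N i) (rep_mod V i) (fun U => @rep_val_fun i U)
  (fun _ _ _ _ => erefl)).
Defined.

Definition rep_in_sec i U (v : rep_mod V i U) : N U :=
  @arrow_in X O (loops Q) (rep_mod V) i U v.

Lemma rep_in_subproof i U (v : rep_mod V i U) :
  tw_base M U (idem O i U) *: rep_in_sec v = rep_in_sec v.
Proof.
rewrite [LHS]mod_of_rep_base; apply: arrow_ext => j.
rewrite /rep_in_sec /arrow_in /idem.
have [<-|ij] := eqVneq i j; first by rewrite eqtype.dfwith_in scale1r.
by rewrite scale0r eqtype.dfwith_out.
Qed.

Definition rep_in_fun i U (v : rep_mod V i U) : vtx_mod N i U :=
  vtx_sub (rep_in_subproof v).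

Lemma rep_val_in i U (v : rep_mod V i U) : rep_val i U (rep_in_fun v) = v.
Proof. exact: eqtype.dfwith_in. Qed.

(** A section fixed by [e_i] has zero components away from [i], since [e_i] acts by 0 on the
    component at any other vertex. *)
Lemma rep_in_val i U (s : vtx_mod N i U) : rep_in_fun (rep_val i U s) = s.
Proof.
apply: vtx_val_inj; apply: (@arrow_ext X O (loops Q)) => j.
have [<-|ij] := eqVneq i j; first exact: eqtype.dfwith_in.
rewrite [LHS]eqtype.dfwith_out// -(vtx_valE s) mod_of_rep_base.
by rewrite /idem eq_sym (negbTE ij) scale0r.
Qed.

End ModuleOfRep.

(** * Recovering a representation from its module *)

Section EssentialSurjectivity.
Variables (X : topologicalType) (O : comRingSheaf X) (Q : quiver).
Variables (M : arrow Q -> modSheaf O) (V : twisted_rep M).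
Implicit Types (i j : vertex Q) (al : arrow Q) (U W : opens X).

Let N := mod_of_rep V.

Lemma rep_arrow_act_in U al (m : M al U) (z : arrow_sec (Q := loops Q) (rep_mod V) U) :
  rep_arrow_act (arrow_in m) z =
  @arrow_in X O (loops Q) (rep_mod V) (head al) U
    (rep_map V al U (tensor_pure m (z (tail al)))).
Proof.
rewrite /rep_arrow_act (bigD1 al) //= big1 => [|be ne].
  by rewrite addr0 {2}/arrow_in eqtype.dfwith_in.
by rewrite {2}/arrow_in eqtype.dfwith_out 1?eq_sym// tensor_pure0l !raddf0.
Qed.

(** The compatibility square of [rep_val] on pure tensors, which determine morphisms out of the
    tensor sheaf. *)
Lemma rep_val_act al U (m : M al U) (s : vtx_mod N (tail al) U) :
  rep_val V (head al) U (vtx_act m s) =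
  rep_map V al U (tensor_pure m (rep_val V (tail al) U s)).
Proof.
have := mod_of_rep_arrow (arrow_in m) (vtx_val s).
rewrite -vtx_val_act rep_arrow_act_in => /(congr1 (fun z => z (head al))) e.
by rewrite [LHS]e /arrow_in eqtype.dfwith_in.
Qed.

Definition rep_val_hom : rep_hom (rep_of_mod N) V.
Proof.
refine (@RepHom X O Q M (rep_of_mod N) V (rep_val V) _).
move=> al; apply: tensor_ext => U m s.
by rewrite !modHom_compE tensor_map_pure rep_of_mod_map rep_val_act.
Defined.

(** The inverse of a linear bijection is linear. *)
Lemma rep_in_linear i U : linear (@rep_in_fun _ _ _ _ V i U).
Proof.
move=> a s t; rewrite -[RHS]rep_in_val; congr rep_in_fun.
by rewrite linearP !rep_val_in.
Qed.
HB.instance Definition _ i U := GRing.isLinear.Build (O U) (rep_mod V i U) (vtx_mod N i U) _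
  (@rep_in_fun _ _ _ _ V i U) (@rep_in_linear i U).

Definition rep_in i : modHom (rep_mod V i) (vtx_mod N i).
Proof.
refine (@ModHom X O (rep_mod V i) (vtx_mod N i) (fun U => @rep_in_fun _ _ _ _ V i U) _).
move=> U W h s; rewrite -[LHS]rep_in_val; congr rep_in_fun.
rewrite -mhom_res; exact: (congr1 (mres (rep_mod V i) h) (rep_val_in s)).
Defined.

Definition rep_in_hom : rep_hom V (rep_of_mod N).
Proof.
refine (@RepHom X O Q M V (rep_of_mod N) rep_in _).
move=> al; apply: tensor_ext => U m s.
rewrite !modHom_compE tensor_map_pure rep_of_mod_map.
rewrite -[RHS]rep_in_val rep_val_act; congr rep_in_fun.
by congr (rep_map V al U (tensor_pure _ _)); rewrite [RHS]rep_val_in.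
Defined.

Lemma rep_val_hom_iso : @is_iso (repCat M) _ _ rep_val_hom.
Proof.
exists rep_in_hom; split; apply: rep_hom_ext => i; apply: modHom_ext => U s.
  exact: rep_in_val.
exact: rep_val_in.
Qed.

End EssentialSurjectivity.

(** * Restriction along a locally surjective morphism of sheaves of rings *)

Section RestrictionFF.
Variables (X : topologicalType) (A A' : ringSheaf X) (phi : ringHom A A').
Hypothesis phi_surj : forall (U : opens X) (b : A' U) x, oset U x ->
  exists (W : opens X) (h : W `<=` U) (a : A W), oset W x /\ rres A' h b = phi W a.

Section Extend.
Variables (M N : modSheaf A') (g : modHom (restr_mod phi M) (restr_mod phi N)).

Definition unrestr_fun U (s : M U) : N U := g U s.

Lemma unrestr_fun_additive U : zmod_morphism (@unrestr_fun U).
Proof. exact: (raddfB (g U)). Qed.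
HB.instance Definition _ U := GRing.isZmodMorphism.Build (M U) (N U)
  (@unrestr_fun U) (@unrestr_fun_additive U).

Lemma unrestr_fun_res (U V : opens X) (h : V `<=` U) s :
  mres N h (unrestr_fun s) = unrestr_fun (mres M h s).
Proof. exact: (mhom_res g). Qed.

(** Linearity can be checked locally, and there the scalar is [phi a], which acts on restricted
    modules as [a]. *)
Lemma unrestr_fun_scalable U : scalable (@unrestr_fun U).
Proof.
move=> b s; apply: mod_eq_local => x /(phi_surj b) [W [h [a [Wx e]]]].
exists W, h; split=> //; rewrite mresZ !unrestr_fun_res mresZ e.
exact: (linearZZ (g W) a).
Qed.
HB.instance Definition _ U := GRing.isScalable.Build (A' U) (M U) (N U) _
  (@unrestr_fun U) (@unrestr_fun_scalable U).

Definition unrestr_hom : modHom M N :=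
  @ModHom X A' M N (fun U => @unrestr_fun U) unrestr_fun_res.

End Extend.

Lemma restriction_ff : fully_faithful (restriction phi).
Proof.
move=> M N; apply: inj_surj_bij => [f g e|g].
  apply: modHom_ext => U s.
  exact: (congr1 (fun k : modHom (restr_mod phi M) (restr_mod phi N) => k U s) e).
by exists (unrestr_hom g); apply: modHom_ext.
Qed.

End RestrictionFF.

(** Sections of the quotient sheaf are locally residue classes, and [repr] lifts such a class to
    [A]. *)
Lemma quot_proj_surj (X : topologicalType) (A : ringSheaf X) (K : idealSheaf A)
    (U : opens X) (b : quot_sheaf K U) x : oset U x ->
  exists (W : opens X) (h : W `<=` U) (a : A W),
    oset W x /\ rres (quot_sheaf K) h b = quot_proj K W a.
Proof.
move=> /(ring_unit_local b) [W [h [t [Wx e]]]].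
by exists W, h, (repr t); split=> //; rewrite e /= qcl_repr.
Qed.

Theorem theorem3p3 (X : topologicalType) (O : comRingSheaf X) (Q : quiver)
    (M : arrow Q -> modSheaf O) :
  (forall a : arrow Q, locally_projective (M a)) ->
  exists Phi : functor (modCat (twisted_algebra M)) (repCat M),
    is_equivalence Phi /\
    forall K : idealSheaf (twisted_algebra M),
      fully_faithful (comp_functor Phi (restriction (quot_proj K))).
Proof.
move=> _; exists (rep_functor M); split=> [|K].
  apply: ff_esurj_equivalence => [|V]; first exact: rep_functor_ff.
  by exists (mod_of_rep V), (rep_val_hom V); exact: rep_val_hom_iso.
(* Modules over the quotient form a full subcategory because restriction of scalars and the
   equivalence are both fully faithful. *)
apply: fully_faithful_comp; first exact: rep_functor_ff.
exact/restriction_ff/quot_proj_surj.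
Qed.
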